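(* Let $\mathcal{M}$ and $\mathcal{N}$ be models of Peano Arithmetic such that $\mathcal{N}$ is a mixed elementary extension of $\mathcal{M}$. Then the interstructure lattice $\mathrm{Lt}(\mathcal{N}/\mathcal{M})$ is not isomorphic to the pentagon lattice $\mathbf{N}_5$.
   Context: Peano Arithmetic (PA) is formulated in the finite language $\{+,\times,\leq,0,1\}$. Models $\mathcal{M},\mathcal{N},\mathcal{K}$ of PA have universes $M,N,K$. $\mathcal{M}\prec\mathcal{N}$ means $\mathcal{M}$ is an elementary substructure of $\mathcal{N}$ (equality allowed). $\mathcal{N}$ is an end elementary extension of $\mathcal{M}$ if $\mathcal{M}\prec\mathcal{N}$ and $a<b$ whenever $a\in M$, $b\in N\setminus M$; it is a cofinal extension of $\mathcal{M}$ if $\mathcal{M}\prec\mathcal{N}$ and for every $b\in N$ there is $a\in M$ with $b<a$. An elementary extension that is neither end nor cofinal is called mixed. For $\mathcal{M}\prec\mathcal{N}$, the interstructure lattice $\mathrm{Lt}(\mathcal{N}/\mathcal{M})$ is the lattice of all $\mathcal{K}$ with $\mathcal{M}\prec\mathcal{K}\prec\mathcal{N}$, ordered by $\prec$. The pentagon lattice $\mathbf{N}_5$ is the five-element lattice $\{0,a,b,c,1\}$ with $0<a<b<1$, $0<c<1$, and $c$ incomparable to both $a$ and $b$. *)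

(* Defs.v *)
From mathcomp Require Import all_boot.
From Stdlib Require Import FunctionalExtensionality PropExtensionality ProofIrrelevance.

Set Implicit Arguments.
Unset Strict Implicit.
Unset Printing Implicit Defensive.

(* Variables are de Bruijn indices. *)
Inductive term : Type :=
| tVar of nat
| tZero
| tOne
| tAdd of term & term
| tMul of term & term.

Inductive formula : Type :=
| fEq of term & term
| fLe of term & term
| fBot
| fImp of formula & formula
| fAll of formula.

Definition fNot (p : formula) : formula := fImp p fBot.
Definition fEx (p : formula) : formula := fNot (fAll (fNot p)).

Definition scons (A : Type) (a : A) (e : nat -> A) : nat -> A :=
  fun i => if i is j.+1 then e j else a.

Fixpoint tsubst (s : nat -> term) (t : term) : term :=
  match t with
  | tVar i => s i
  | tZero => tZero
  | tOne => tOne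
  | tAdd t1 t2 => tAdd (tsubst s t1) (tsubst s t2)
  | tMul t1 t2 => tMul (tsubst s t1) (tsubst s t2)
  end.

Definition tshift : term -> term := tsubst (fun i => tVar i.+1).

Fixpoint fsubst (s : nat -> term) (p : formula) : formula :=
  match p with
  | fEq t1 t2 => fEq (tsubst s t1) (tsubst s t2)
  | fLe t1 t2 => fLe (tsubst s t1) (tsubst s t2)
  | fBot => fBot
  | fImp p1 p2 => fImp (fsubst s p1) (fsubst s p2)
  | fAll p1 => fAll (fsubst (scons (tVar 0) (fun i => tshift (s i))) p1)
  end.

Record structure : Type := Structure {
  carrier :> Type;
  s_zero : carrier;
  s_one : carrier;
  s_add : carrier -> carrier -> carrier;
  s_mul : carrier -> carrier -> carrier;
  s_le : carrier -> carrier -> Prop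
}.

Definition s_lt (A : structure) (x y : A) : Prop := s_le x y /\ x <> y.

Fixpoint eval (A : structure) (e : nat -> A) (t : term) : A :=
  match t with
  | tVar i => e i
  | tZero => s_zero A
  | tOne => s_one A
  | tAdd t1 t2 => s_add (eval e t1) (eval e t2)
  | tMul t1 t2 => s_mul (eval e t1) (eval e t2)
  end.

Fixpoint sat (A : structure) (e : nat -> A) (p : formula) : Prop :=
  match p with
  | fEq t1 t2 => eval e t1 = eval e t2
  | fLe t1 t2 => s_le (eval e t1) (eval e t2)
  | fBot => False
  | fImp p1 p2 => sat e p1 -> sat e p2
  | fAll p1 => forall a : A, sat (scons a e) p1
  end.

(* The axioms are given with free variables and are read as their universal
   closures. In [PA_induction], variable 0 of [p] is the induction variable and
   the others are parameters. *)
Inductive PA : formula -> Prop :=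
| PA_succ_neq0 : PA (fNot (fEq (tAdd (tVar 0) tOne) tZero))
| PA_succ_inj :
    PA (fImp (fEq (tAdd (tVar 0) tOne) (tAdd (tVar 1) tOne))
             (fEq (tVar 0) (tVar 1)))
| PA_add0 : PA (fEq (tAdd (tVar 0) tZero) (tVar 0))
| PA_addS :
    PA (fEq (tAdd (tVar 0) (tAdd (tVar 1) tOne))
            (tAdd (tAdd (tVar 0) (tVar 1)) tOne))
| PA_mul0 : PA (fEq (tMul (tVar 0) tZero) tZero)
| PA_mulS :
    PA (fEq (tMul (tVar 0) (tAdd (tVar 1) tOne))
            (tAdd (tMul (tVar 0) (tVar 1)) (tVar 0)))
| PA_le_diff :
    PA (fImp (fLe (tVar 0) (tVar 1))
             (fEx (fEq (tAdd (tVar 1) (tVar 0)) (tVar 2))))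
| PA_diff_le :
    PA (fImp (fEx (fEq (tAdd (tVar 1) (tVar 0)) (tVar 2)))
             (fLe (tVar 0) (tVar 1)))
| PA_induction (p : formula) :
    PA (fImp (fsubst (scons tZero tVar) p)
       (fImp (fAll (fImp p (fsubst (scons (tAdd (tVar 0) tOne)
                                          (fun i => tVar i.+1)) p)))
             (fAll p))).

Definition models_PA (A : structure) : Prop :=
  forall p, PA p -> forall e : nat -> A, sat e p.

Record substructure (N : structure) : Type := Substructure {
  univ :> N -> Prop;
  univ_zero : univ (s_zero N);
  univ_one : univ (s_one N);
  univ_add : forall x y, univ x -> univ y -> univ (s_add x y);
  univ_mul : forall x y, univ x -> univ y -> univ (s_mul x y)
}.

Definition induced (N : structure) (K : substructure N) : structure :=
  @Structure {x : N | K x}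
    (exist _ _ (univ_zero K))
    (exist _ _ (univ_one K))
    (fun x y => exist _ _ (univ_add (proj2_sig x) (proj2_sig y)))
    (fun x y => exist _ _ (univ_mul (proj2_sig x) (proj2_sig y)))
    (fun x y => s_le (proj1_sig x) (proj1_sig y)).

Definition elementary (A B : structure) (f : A -> B) : Prop :=
  forall (p : formula) (e : nat -> A), sat e p <-> sat (fun i => f (e i)) p.

Definition elem_sub (N : structure) (K : substructure N) : Prop :=
  @elementary (induced K) N (fun x => proj1_sig x).

Definition inclusion (N : structure) (K K' : substructure N)
    (s : forall x, K x -> K' x) : induced K -> induced K' :=
  fun x => exist _ (proj1_sig x) (s _ (proj2_sig x)).

Definition prec (N : structure) (K K' : substructure N) : Prop :=
  exists s : forall x, K x -> K' x, elementary (inclusion s).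

Definition end_ext (N : structure) (M : substructure N) : Prop :=
  elem_sub M /\ forall a b : N, M a -> ~ M b -> s_lt a b.

Definition cofinal_ext (N : structure) (M : substructure N) : Prop :=
  elem_sub M /\ forall b : N, exists a : N, M a /\ s_lt b a.

Definition mixed_ext (N : structure) (M : substructure N) : Prop :=
  [/\ elem_sub M, ~ end_ext M & ~ cofinal_ext M].

Definition Lt (N : structure) (M : substructure N) : Type :=
  {K : substructure N | prec M K /\ elem_sub K}.

Definition Lt_le (N : structure) (M : substructure N) (K K' : Lt M) : Prop :=
  prec (proj1_sig K) (proj1_sig K').

(* Mutually included elements of [Lt M] are Leibniz-equal, so that [bijective]
   below is meant with respect to the intended equality. *)
Lemma Lt_le_anti (N : structure) (M : substructure N) (K K' : Lt M) :
  Lt_le K K' -> Lt_le K' K -> K = K'.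
Proof.
case: K K' => [[U z o a m] h] [[U' z' o' a' m'] h'] [s _] [s' _] /=.
have eU : U = U'.
  by apply: functional_extensionality => x;
     apply: propositional_extensionality; split; [apply: s | apply: s'].
move: z o a m h s s'; rewrite eU => z o a m h _ _.
move: h; rewrite (proof_irrelevance _ z z') (proof_irrelevance _ o o')
  (proof_irrelevance _ a a') (proof_irrelevance _ m m') => h.
by rewrite (proof_irrelevance _ h h').
Qed.

Inductive pentagon : Type := N5_0 | N5_a | N5_b | N5_c | N5_1.

(* 0 < a < b < 1 and 0 < c < 1, with c incomparable to a and b. *)
Definition N5_le (x y : pentagon) : Prop :=
  match x, y with
  | N5_0, _ | _, N5_1
  | N5_a, N5_a | N5_a, N5_b | N5_b, N5_b | N5_c, N5_c => True
  | _, _ => False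
  end.

(* An order isomorphism between lattices is the same as a lattice isomorphism. *)
Definition order_isomorphic (A B : Type)
    (leA : A -> A -> Prop) (leB : B -> B -> Prop) : Prop :=
  exists f : A -> B,
    bijective f /\ forall x y : A, leA x y <-> leB (f x) (f y).

(* Main.v *)
From mathcomp Require Import all_boot.
From Stdlib Require Import FunctionalExtensionality PropExtensionality ProofIrrelevance.
From Stdlib Require Import Classical ClassicalEpsilon Setoid Ring.
Require Import Defs.

Set Implicit Arguments.
Unset Strict Implicit.
Unset Printing Implicit Defensive.

(* Let K be the set of elements of N below some element of M. By collection K is
   an elementary substructure, and as N is a mixed extension, K is one of the
   points a, b, c of the pentagon; write A < B and C for these three models.

   If K = C, a definition of an element of B over A and K uses a parameter k of K
   which can be chosen in B, hence in M; so B = A. If K = B, the restriction to an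
   interval bounded in M of a relation definable over C is coded by an element
   of C that is bounded in M, hence in M; so again B = A.

   Let K = A. Then B is an initial segment of N that lies below C minus M. Pick z
   in B minus A. As z is definable from some j in A and c in C, with j below some
   m in M, the values at the arguments below m of a function definable from c are
   coinitial in C minus M. Bounding quantifiers by these values yields a family of
   sets (R_i), coded in C, in which truth of every formula in B is computed by R_i
   for some i in M. This is where the finite language is used, since all formulas
   are treated by one recursion. As the family is coded in N, diagonalization
   produces an element of B that is not definable from z over M, whereas z
   generates B over M. *)

(* Notation, substitution and satisfaction *)
Declare Scope pa_scope.
Delimit Scope pa_scope with PA.
Notation "x + y" := (s_add x y) : pa_scope.
Notation "x * y" := (s_mul x y) : pa_scope.
Notation "x <= y" := (s_le x y) : pa_scope.
Notation "x < y" := (s_lt x y) : pa_scope.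

Lemma scons_eta (A : Type) (e : nat -> A) : scons (e 0) (fun i => e i.+1) = e.
Proof. by apply: functional_extensionality; case. Qed.

Lemma eval_subst (A : structure) (e : nat -> A) s t :
  eval e (tsubst s t) = eval (fun i => eval e (s i)) t.
Proof. by elim: t => //= t1 -> t2 ->. Qed.

Lemma sat_subst (A : structure) p (e : nat -> A) s :
  sat e (fsubst s p) <-> sat (fun i => eval e (s i)) p.
Proof.
elim: p e s => /= [t1 t2|t1 t2||p IHp q IHq|p IHp] e s.
- by rewrite !eval_subst.
- by rewrite !eval_subst.
- by [].
- by rewrite IHp IHq.
- split=> H a; have {H} := H a; rewrite IHp; congr (sat _ p);
  by apply: functional_extensionality; case=> //= i; rewrite /tshift eval_subst.
Qed.

Lemma sat_ex (A : structure) (e : nat -> A) p :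
  sat e (fEx p) <-> exists a, sat (scons a e) p.
Proof.
split=> [H|[a Ha] H]; last exact: (H a).
by apply: NNPP => H'; apply: H => a Ha; apply: H'; exists a.
Qed.

(** * Definable relations and functions *)

Section Definability.
Variable N : structure.
Local Open Scope pa_scope.
Implicit Types (P Q : (nat -> N) -> Prop) (f g : (nat -> N) -> N).

(** Predicates on whole environments treat relations of all arities at once. Definability is without
    parameters; these enter as further variables. *)
Definition dfn P := exists p, forall e, sat e p <-> P e.
Definition dff f := dfn (fun e => e 0 = f (fun i => e i.+1)).

Lemma dfn_iff P Q : (forall e, P e <-> Q e) -> dfn P -> dfn Q.
Proof. by move=> PQ [p Hp]; exists p => e; rewrite Hp PQ. Qed.

Lemma dfn_false : dfn (fun _ => False).
Proof. by exists fBot. Qed.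

Lemma dfn_imp P Q : dfn P -> dfn Q -> dfn (fun e => P e -> Q e).
Proof. by case=> p Hp [q Hq]; exists (fImp p q) => e /=; rewrite Hp Hq. Qed.

Lemma dfn_not P : dfn P -> dfn (fun e => ~ P e).
Proof. by move=> hP; apply: dfn_imp => //; apply: dfn_false. Qed.

Lemma dfn_and P Q : dfn P -> dfn Q -> dfn (fun e => P e /\ Q e).
Proof.
move=> hP hQ; apply: (@dfn_iff (fun e => ~ (P e -> ~ Q e))); last first.
  by apply/dfn_not/dfn_imp => //; apply: dfn_not.
by move=> e; tauto.
Qed.

Lemma dfn_or P Q : dfn P -> dfn Q -> dfn (fun e => P e \/ Q e).
Proof.
move=> hP hQ; apply: (@dfn_iff (fun e => ~ P e -> Q e)); last first.
  by apply: dfn_imp => //; apply: dfn_not.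
by move=> e; tauto.
Qed.

Lemma dfn_equiv P Q : dfn P -> dfn Q -> dfn (fun e => P e <-> Q e).
Proof. by move=> hP hQ; apply: dfn_and; apply: dfn_imp. Qed.

Lemma dfn_all (R : N -> (nat -> N) -> Prop) :
  dfn (fun e => R (e 0) (fun i => e i.+1)) -> dfn (fun e => forall x, R x e).
Proof.
case=> p Hp; exists (fAll p) => e /=.
by split=> H a; have := H a; rewrite Hp.
Qed.

Lemma dfn_ex (R : N -> (nat -> N) -> Prop) :
  dfn (fun e => R (e 0) (fun i => e i.+1)) -> dfn (fun e => exists x, R x e).
Proof.
case=> p Hp; exists (fEx p) => e; rewrite sat_ex.
by split=> -[a Ha]; exists a; move: Ha; rewrite Hp.
Qed.

Lemma dfn_subst P (s : nat -> term) :
  dfn P -> dfn (fun e => P (fun i => eval e (s i))).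
Proof. by case=> p Hp; exists (fsubst s p) => e; rewrite sat_subst Hp. Qed.

Lemma dfn_ren P (r : nat -> nat) : dfn P -> dfn (fun e => P (fun i => e (r i))).
Proof. by move/(dfn_subst (fun i => tVar (r i))). Qed.

Lemma dfn_eq_var i j : dfn (fun e => e i = e j).
Proof. by exists (fEq (tVar i) (tVar j)). Qed.

Lemma dff_term t : dff (fun e => eval e t).
Proof.
exists (fEq (tVar 0) (tshift t)) => e /=.
by rewrite /tshift eval_subst.
Qed.

Lemma dff_var i : dff (fun e => e i).
Proof. exact: (dff_term (tVar i)). Qed.
Lemma dff_zero : dff (fun e => s_zero N).
Proof. exact: (dff_term tZero). Qed.
Lemma dff_one : dff (fun e => s_one N).
Proof. exact: (dff_term tOne). Qed.

(** A definable function is substituted by quantifying over its value, since only its graph is given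
    by a formula. *)
Lemma dfn_app1 (R : N -> Prop) f :
  dfn (fun e => R (e 0)) -> dff f -> dfn (fun e => R (f e)).
Proof.
move=> hR hf; apply: (@dfn_iff (fun e => exists x, x = f e /\ R x)).
  by move=> e; split=> [[x [-> //]]|H]; exists (f e).
apply: dfn_ex; apply: dfn_and => //.
Qed.

Lemma dfn_app2 (R : N -> N -> Prop) f g :
  dfn (fun e => R (e 0) (e 1)) -> dff f -> dff g -> dfn (fun e => R (f e) (g e)).
Proof.
move=> hR hf hg.
apply: (@dfn_iff (fun e => exists y, y = g e /\ exists x, x = f e /\ R x y)).
  move=> e; split=> [[y [-> [x [-> //]]]]|H].
  by exists (g e); split=> //; exists (f e).
apply: dfn_ex; apply: dfn_and => //; apply: dfn_ex; apply: dfn_and => //.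
(* Variable 1 is the value of [g] bound just before, which the graph of [f] has to skip. *)
exact: (dfn_ren (fun i => if i is j.+1 then j.+2 else 0) hf).
Qed.

Lemma dfn_app3 (R : N -> N -> N -> Prop) f g h :
  dfn (fun e => R (e 0) (e 1) (e 2)) -> dff f -> dff g -> dff h ->
  dfn (fun e => R (f e) (g e) (h e)).
Proof.
move=> hR hf hg hh.
apply: (@dfn_iff (fun e => exists z, z = h e /\ exists y, y = g e /\
    exists x, x = f e /\ R x y z)).
  move=> e; split=> [[z [-> [y [-> [x [-> //]]]]]]|H].
  by exists (h e); split=> //; exists (g e); split=> //; exists (f e).
apply: dfn_ex; apply: dfn_and => //; apply: dfn_ex; apply: dfn_and.
  exact: (dfn_ren (fun i => if i is j.+1 then j.+2 else 0) hg).
apply: dfn_ex; apply: dfn_and => //.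
exact: (dfn_ren (fun i => if i is j.+1 then j.+3 else 0) hf).
Qed.

Lemma dfn_eq f g : dff f -> dff g -> dfn (fun e => f e = g e).
Proof. by apply: dfn_app2; exact: dfn_eq_var. Qed.

Lemma dfn_le f g : dff f -> dff g -> dfn (fun e => f e <= g e).
Proof. by apply: dfn_app2; exists (fLe (tVar 0) (tVar 1)). Qed.

Lemma dff_app1 (F : N -> N) f :
  dfn (fun e => e 0 = F (e 1)) -> dff f -> dff (fun e => F (f e)).
Proof.
move=> hF hf; apply: (@dfn_app2 (fun x y => x = F y)) => //; first exact: dff_var.
exact: (dfn_ren (fun i => if i is j.+1 then j.+2 else 0) hf).
Qed.

Lemma dff_app2 (F : N -> N -> N) f g :
  dfn (fun e => e 0 = F (e 1) (e 2)) -> dff f -> dff g ->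
  dff (fun e => F (f e) (g e)).
Proof.
move=> hF hf hg; apply: (@dfn_app3 (fun x y z => x = F y z)) => //.
- exact: dff_var.
- exact: (dfn_ren (fun i => if i is j.+1 then j.+2 else 0) hf).
- exact: (dfn_ren (fun i => if i is j.+1 then j.+2 else 0) hg).
Qed.

Lemma dff_add f g : dff f -> dff g -> dff (fun e => f e + g e).
Proof.
by apply: (@dff_app2 (fun x y => x + y));
  exists (fEq (tVar 0) (tAdd (tVar 1) (tVar 2))).
Qed.

Lemma dff_mul f g : dff f -> dff g -> dff (fun e => f e * g e).
Proof.
by apply: (@dff_app2 (fun x y => x * y));
  exists (fEq (tVar 0) (tMul (tVar 1) (tVar 2))).
Qed.

End Definability.

(** Definability is proved by following the syntax of the predicate. *)
Ltac dfn_step :=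
  lazymatch goal with
  | |- dff (fun e => e _) => apply: dff_var
  | |- dff (fun e => s_zero _) => apply: dff_zero
  | |- dff (fun e => s_one _) => apply: dff_one
  | |- dff (fun e => s_add _ _) => apply: dff_add
  | |- dff (fun e => s_mul _ _) => apply: dff_mul
  | |- dfn (fun e => False) => apply: dfn_false
  | |- dfn (fun e => ~ _) => apply: dfn_not
  | |- dfn (fun e => _ /\ _) => apply: dfn_and
  | |- dfn (fun e => _ \/ _) => apply: dfn_or
  | |- dfn (fun e => _ <-> _) => apply: dfn_equiv
  | |- dfn (fun e => exists x, _) => apply: dfn_ex; cbv beta
  | |- dfn (fun e => s_le _ _) => apply: dfn_le
  | |- dfn (fun e => @eq _ _ _) => apply: dfn_eq
  | |- dfn (fun e => forall x : carrier _, _) => apply: dfn_all; cbv beta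
  | |- dfn (fun e => _ -> _) => apply: dfn_imp
  end.
Ltac dfn := repeat dfn_step.

(** * Arithmetic in a model of PA *)

Section Model.
Variable N : structure.
Hypothesis hN : models_PA N.
Local Open Scope pa_scope.
Local Notation z0 := (s_zero N).
Local Notation z1 := (s_one N).
Implicit Types x y z u v w : N.

Lemma PA_ind_env (R : N -> (nat -> N) -> Prop) (c : nat -> N) :
  dfn (fun e => R (e 0) (fun i => e i.+1)) ->
  R z0 c -> (forall x, R x c -> R (x + z1) c) -> forall x, R x c.
Proof.
case=> p Hp H0 H1 x.
have E y : sat (scons y c) p <-> R y c by rewrite Hp.
have /= := hN (PA_induction p) c; rewrite sat_subst => H.
have {H}H : forall a, sat (scons a c) p; last by rewrite -E.
apply: H => [|a]; first by rewrite -E in H0; move: H0; congr (sat _ p);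
  apply: functional_extensionality; case.
rewrite sat_subst E => /H1; rewrite -E; congr (sat _ p).
by apply: functional_extensionality; case.
Qed.

Lemma PA_ind (R : N -> Prop) : dfn (fun e => R (e 0)) ->
  R z0 -> (forall x, R x -> R (x + z1)) -> forall x, R x.
Proof. by move=> hR; apply: (@PA_ind_env (fun x _ => R x) (fun _ => z0)). Qed.

Lemma PA_ind1 (R : N -> N -> Prop) u : dfn (fun e => R (e 0) (e 1)) ->
  R z0 u -> (forall x, R x u -> R (x + z1) u) -> forall x, R x u.
Proof. by move=> hR; apply: (@PA_ind_env (fun x c => R x (c 0)) (fun _ => u)). Qed.

Lemma PA_ind2 (R : N -> N -> N -> Prop) u v : dfn (fun e => R (e 0) (e 1) (e 2)) ->
  R z0 u v -> (forall x, R x u v -> R (x + z1) u v) -> forall x, R x u v.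
Proof.
(* Parameters are passed as a list read by [nth], whose default fills the remaining variables. *)
by move=> hR; apply: (@PA_ind_env (fun x c => R x (c 0) (c 1)) (nth u [:: u; v])).
Qed.

Let env2 x y := scons x (scons y (fun _ => z0)).

Lemma addS_neq0 x : x + z1 <> z0.
Proof. by move: (hN PA_succ_neq0 (env2 x x)). Qed.
Lemma addSI x y : x + z1 = y + z1 -> x = y.
Proof. by move: (hN PA_succ_inj (env2 x y)). Qed.
Lemma addx0 x : x + z0 = x.
Proof. by move: (hN PA_add0 (env2 x x)). Qed.
Lemma addxS x y : x + (y + z1) = (x + y) + z1.
Proof. by move: (hN PA_addS (env2 x y)). Qed.
Lemma mulx0 x : x * z0 = z0.
Proof. by move: (hN PA_mul0 (env2 x x)). Qed.
Lemma mulxS x y : x * (y + z1) = x * y + x.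
Proof. by move: (hN PA_mulS (env2 x y)). Qed.
Lemma leE x y : x <= y <-> exists z, x + z = y.
Proof.
have E : sat (env2 x y) (fEx (fEq (tAdd (tVar 1) (tVar 0)) (tVar 2))) <->
    exists z, x + z = y by rewrite sat_ex; apply: iff_refl.
rewrite -E; split; first exact: (hN PA_le_diff (env2 x y)).
exact: (hN PA_diff_le (env2 x y)).
Qed.

Lemma add0x x : z0 + x = x.
Proof.
move: x; apply: PA_ind; [dfn|exact: addx0|by move=> x IH; rewrite addxS IH].
Qed.
Lemma addSx x y : (x + z1) + y = (x + y) + z1.
Proof.
move: y; apply: (@PA_ind1 (fun y x => (x + z1) + y = (x + y) + z1)); first dfn.
  by rewrite !addx0.
by move=> y IH; rewrite !addxS IH.
Qed.
Lemma addC x y : x + y = y + x.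
Proof.
move: y; apply: (@PA_ind1 (fun y x => x + y = y + x)); first dfn.
  by rewrite addx0 add0x.
by move=> y IH; rewrite addxS addSx IH.
Qed.
Lemma addA x y z : x + (y + z) = (x + y) + z.
Proof.
move: z; apply: (@PA_ind2 (fun z x y => x + (y + z) = (x + y) + z)); first dfn.
  by rewrite !addx0.
by move=> z IH; rewrite !addxS IH.
Qed.
Lemma mul0x x : z0 * x = z0.
Proof.
move: x; apply: PA_ind; [dfn|exact: mulx0|by move=> x IH; rewrite mulxS IH addx0].
Qed.
Lemma mulSx x y : (x + z1) * y = x * y + y.
Proof.
move: y; apply: (@PA_ind1 (fun y x => (x + z1) * y = x * y + y)); first dfn.
  by rewrite !mulx0 addx0.
move=> y IH; rewrite !mulxS IH -!addA; congr (_ + _).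
by rewrite !addA; congr (_ + _); rewrite addC.
Qed.
Lemma mulC x y : x * y = y * x.
Proof.
move: y; apply: (@PA_ind1 (fun y x => x * y = y * x)); first dfn.
  by rewrite mulx0 mul0x.
by move=> y IH; rewrite mulxS mulSx IH.
Qed.
Lemma mulDl x y z : (x + y) * z = x * z + y * z.
Proof.
move: z; apply: (@PA_ind2 (fun z x y => (x + y) * z = x * z + y * z)); first dfn.
  by rewrite !mulx0 addx0.
move=> z IH; rewrite !mulxS IH -!addA; congr (_ + _).
by rewrite !addA; congr (_ + _); rewrite addC.
Qed.
Lemma mulA x y z : x * (y * z) = (x * y) * z.
Proof.
move: z; apply: (@PA_ind2 (fun z x y => x * (y * z) = (x * y) * z)); first dfn.
  by rewrite !mulx0.
by move=> z IH; rewrite !mulxS -IH mulC mulDl mulC [y * x]mulC.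
Qed.
Lemma mul1x x : z1 * x = x.
Proof. by rewrite -{1}[z1]add0x mulSx mul0x add0x. Qed.

Lemma N_semi_ring : semi_ring_theory z0 z1 (@s_add N) (@s_mul N) (@eq N).
Proof.
split; [exact: add0x|exact: addC|exact: addA|exact: mul1x|exact: mul0x
 |exact: mulC|exact: mulA|exact: mulDl].
Qed.
Add Ring N_ring : N_semi_ring.

(** * Cancellation and order *)

Lemma addIx x y z : x + z = y + z -> x = y.
Proof.
move: z; apply: (@PA_ind2 (fun z x y => x + z = y + z -> x = y)); first dfn.
  by rewrite !addx0.
by move=> z IH; rewrite !addxS => /addSI.
Qed.
Lemma addxI x y z : x + y = x + z -> y = z.
Proof. by rewrite ![x + _]addC => /addIx. Qed.
Lemma zero_or_succ x : x = z0 \/ exists y, x = y + z1.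
Proof.
move: x; apply: PA_ind; [dfn|by left|by move=> x _; right; exists x].
Qed.
Lemma add_eq0 x y : x + y = z0 -> x = z0 /\ y = z0.
Proof.
case: (zero_or_succ y) => [->|[y' ->]]; first by rewrite addx0.
by rewrite addxS => /addS_neq0.
Qed.

Lemma le_addr x y : x <= x + y.
Proof. by rewrite leE; exists y. Qed.
Lemma le_addl x y : x <= y + x.
Proof. by rewrite leE; exists y; ring. Qed.
Lemma lexx x : x <= x.
Proof. by rewrite leE; exists z0; ring. Qed.
Lemma le0x x : z0 <= x.
Proof. by rewrite leE; exists x; ring. Qed.
Lemma le_trans y x z : x <= y -> y <= z -> x <= z.
Proof. by rewrite !leE => -[a <-] [b <-]; exists (a + b); ring. Qed.
Lemma le_anti x y : x <= y -> y <= x -> x = y.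
Proof.
rewrite !leE => -[a <-] [b H].
have /add_eq0 [-> _] : a + b = z0 by apply: (@addxI x); rewrite addA H addx0.
by ring.
Qed.
Lemma le_lt_total x y : x <= y \/ y + z1 <= x.
Proof.
move: x; apply: (@PA_ind1 (fun x y => x <= y \/ y + z1 <= x)); first dfn.
  by left; exact: le0x.
move=> x [|H]; last by right; apply: le_trans H (le_addr _ _).
rewrite leE => -[a <-]; case: (zero_or_succ a) => [->|[b ->]].
  by right; rewrite addx0; exact: lexx.
by left; rewrite leE; exists b; ring.
Qed.
Lemma succ_le_irr x : ~ x + z1 <= x.
Proof.
rewrite leE => -[a H].
have : z1 + a = z0 by apply: (@addxI x); rewrite addA H addx0.
by rewrite addC => /addS_neq0.
Qed.
Lemma not_le x y : ~ x <= y <-> y + z1 <= x.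
Proof.
split=> [H|H H']; first by case: (le_lt_total x y).
exact: (@succ_le_irr y (le_trans H H')).
Qed.
Lemma le_total x y : x <= y \/ y <= x.
Proof.
by case: (le_lt_total x y); [left|right; apply: (@le_trans (y + z1)) => //; exact: le_addr].
Qed.
Lemma ltE x y : x < y <-> x + z1 <= y.
Proof.
rewrite -not_le; split=> [[h1 h2] h3|H]; first by apply: h2; exact: le_anti.
by case: (le_total x y) => // h; split=> // E; apply: H; rewrite E; exact: lexx.
Qed.
Lemma le_succ x y : x <= y + z1 <-> x <= y \/ x = y + z1.
Proof.
split=> [|[H|->]]; last exact: lexx.
  rewrite leE => -[a]; case: (zero_or_succ a) => [->|[b ->]].
    by rewrite addx0; right.
  by rewrite addxS => /addSI <-; left; exact: le_addr.
exact: le_trans H (le_addr _ _).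
Qed.
Lemma le_add x y u v : x <= y -> u <= v -> x + u <= y + v.
Proof. by rewrite !leE => -[a <-] [b <-]; exists (a + b); ring. Qed.
Lemma le_mul x y u v : x <= y -> u <= v -> x * u <= y * v.
Proof.
rewrite !leE => -[a <-] [b <-]; exists (a * u + x * b + a * b); ring.
Qed.

(** Without a least element, induction on [x] shows that no element up to [x] satisfies [R]. *)
Lemma least_env (R : N -> (nat -> N) -> Prop) (c : nat -> N) :
  dfn (fun e => R (e 0) (fun i => e i.+1)) -> (exists x, R x c) ->
  exists x, R x c /\ forall y, R y c -> x <= y.
Proof.
move=> hR [x Rx]; apply: NNPP => H.
suff {x Rx} : forall x, forall y, y <= x -> ~ R y c by move/(_ x x (lexx x)).
apply: (@PA_ind_env (fun x c => forall y, y <= x -> ~ R y c)).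
- dfn; apply: (dfn_ren (fun i => if i is j.+1 then j.+2 else 0) hR).
- move=> y hy Ry; apply: H; exists y; split=> // z _.
  by rewrite (le_anti hy (le0x _)); exact: le0x.
- move=> x IH y; rewrite le_succ => -[/IH //|-> Ry]; apply: H; exists (x + z1).
  split=> // z Rz; rewrite -not_le => hz; exact: (IH z).
Qed.

(** The least upper bound satisfies [R]: otherwise it is zero, against nonemptiness, or its
    predecessor is also an upper bound. *)
Lemma greatest_env (R : N -> (nat -> N) -> Prop) (c : nat -> N) b :
  dfn (fun e => R (e 0) (fun i => e i.+1)) -> (exists x, R x c) ->
  (forall x, R x c -> x <= b) ->
  exists x, R x c /\ forall y, R y c -> y <= x.
Proof.
move=> hR [x0 Rx0] Rb.
have [|//|x [Hx hx]] := @least_env (fun x c => forall y, R y c -> y <= x) c.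
- dfn; apply: (dfn_ren (fun i => if i is j.+1 then j.+2 else 0) hR).
- by exists b.
exists x; split=> //; apply: NNPP => nRx.
case: (zero_or_succ x) => [E|[x' E]].
  by apply: nRx; rewrite E -(le_anti (x := x0) (y := z0)) //; [rewrite -E; exact: Hx|exact: le0x].
apply: (@succ_le_irr x'); rewrite -E; apply: hx => y Ry.
by have := Hx y Ry; rewrite E le_succ => -[//|Ey]; case: nRx; rewrite E -Ey.
Qed.

Lemma collection (R : N -> N -> (nat -> N) -> Prop) (c : nat -> N) m :
  dfn (fun e => R (e 0) (e 1) (fun i => e i.+2)) ->
  exists b, forall x, x <= m -> (exists y, R x y c) -> exists y, y <= b /\ R x y c.
Proof.
move=> hR; move: m; apply: (@PA_ind_env (fun m c =>
  exists b, forall x, x <= m -> (exists y, R x y c) -> exists y, y <= b /\ R x y c)).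
- dfn.
  (* From the innermost outwards, the variables are [y], [x], [b], [m] and then those of [c]. *)
  + exact: (dfn_ren (fun i => if i is j.+2 then j.+4 else if i is 1 then 0 else 1) hR).
  + exact: (dfn_ren (fun i => if i is j.+2 then j.+4 else if i is 1 then 0 else 1) hR).
- case: (classic (exists y, R z0 y c)) => [[y Ry]|H]; last first.
    by exists z0 => x hx; rewrite (le_anti hx (le0x _)).
  exists y => x hx _; exists y; split; first exact: lexx.
  by rewrite (le_anti hx (le0x _)).
- move=> m [b Hb]; case: (classic (exists y, R (m + z1) y c)) => [[y Ry]|H].
    exists (b + y) => x; rewrite le_succ => -[/Hb h /h [y' [h1 h2]]|-> _].
      by exists y'; split=> //; apply: le_trans h1 (le_addr _ _).
    by exists y; split=> //; exact: le_addl.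
  exists b => x; rewrite le_succ => -[/Hb h /h //|-> //].
Qed.

(** * Pairing and codes of environments *)

Definition pair x y := (x + y) * (x + y) + x.

(** With [s = x + y], the code lies from the square of [s] up to, but below, the square of [s + 1];
    it thus determines [s], and then [x]. *)
Lemma pair_inj x y x' y' : pair x y = pair x' y' -> x = x' /\ y = y'.
Proof.
have aux u v u' v' : u + v + z1 <= u' + v' -> pair u v <> pair u' v'.
  rewrite leE /pair => -[a Ha] H.
  have : (u + v + z1 + a) * (u + v + z1 + a) + u' = (u + v) * (u + v) + u.
    by rewrite Ha.
  (* This is the excess of the left side over the right one, minus one; [u] is cancelled against a
     copy of [s], leaving [v]. *)
  set s := u + v => E; apply: (@addS_neq0 ((s + v + (z1 + z1) * s * a + (z1+z1) * a + a * a) + u')).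
  apply: (@addxI (s * s + u)); rewrite addx0 -[RHS]E /s; ring.
move=> H; case: (le_lt_total (x + y) (x' + y')) => [h|/aux h]; last by case: h.
case: (le_lt_total (x' + y') (x + y)) => [h'|/aux h']; last by case: h'.
have E := le_anti h h'; move: H; rewrite /pair E => /addxI Ex.
by split=> //; apply: (@addxI x); rewrite E Ex.
Qed.

Lemma le_pair x y x' y' : x <= x' -> y <= y' -> pair x y <= pair x' y'.
Proof.
move=> hx hy; apply: le_add => //.
by apply: le_mul; apply: le_add.
Qed.
Lemma le_sqr x : x <= x * x.
Proof.
case: (zero_or_succ x) => [->|[y ->]]; first exact: le0x.
by rewrite leE; exists (y * y + y); ring.
Qed.
Lemma le_pair1 x y : x <= pair x y. Proof. exact: le_addl. Qed.
Lemma le_pair2 x y : y <= pair x y.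
Proof.
apply: (@le_trans (x + y)); first exact: le_addl.
by apply: (@le_trans ((x + y) * (x + y))); [exact: le_sqr|exact: le_addr].
Qed.

Lemma dff_pair f g : dff f -> dff g -> dff (fun e => pair (f e) (g e)).
Proof. by move=> hf hg; rewrite /pair; dfn. Qed.

(** The pairing is not onto; the value zero off its range keeps both projections total and
    definable. *)
Definition pi1 b : N := epsilon (inhabits z0)
  (fun x => exists y, b = pair x y \/ (~ (exists x y, b = pair x y)) /\ x = z0).
Definition pi2 b : N := epsilon (inhabits z0)
  (fun y => exists x, b = pair x y \/ (~ (exists x y, b = pair x y)) /\ y = z0).

Lemma pi1E b x : x = pi1 b <->
  exists y, b = pair x y \/ (~ (exists x y, b = pair x y)) /\ x = z0.
Proof.
have H : exists x y, b = pair x y \/ (~ (exists x y, b = pair x y)) /\ x = z0.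
  case: (classic (exists x y, b = pair x y)) => [[u [v h]]|h].
    by exists u, v; left.
  by exists z0, z0; right.
have := epsilon_spec (inhabits z0) _ H; rewrite -/(pi1 b) => {H} H.
split=> [->//|[y Hx]]; case: H => y' Hy'.
case: Hx Hy' => [Hx [Hy'|[h _]]|[h Hx] [Hy'|[_ Hy']]].
- by have [] : x = pi1 b /\ y = y' by apply: pair_inj; rewrite -Hx.
- by case: h; exists x, y.
- by case: h; exists (pi1 b), y'.
- by rewrite Hx -Hy'.
Qed.

Lemma pi2E b y : y = pi2 b <->
  exists x, b = pair x y \/ (~ (exists x y, b = pair x y)) /\ y = z0.
Proof.
have H : exists y x, b = pair x y \/ (~ (exists x y, b = pair x y)) /\ y = z0.
  case: (classic (exists x y, b = pair x y)) => [[u [v h]]|h].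
    by exists v, u; left.
  by exists z0, z0; right.
have := epsilon_spec (inhabits z0) _ H; rewrite -/(pi2 b) => {H} H.
split=> [->//|[x Hx]]; case: H => x' Hy'.
case: Hx Hy' => [Hx [Hy'|[h _]]|[h Hx] [Hy'|[_ Hy']]].
- by have [] : x = x' /\ y = pi2 b by apply: pair_inj; rewrite -Hx.
- by case: h; exists x, y.
- by case: h; exists x', (pi2 b).
- by rewrite Hx -Hy'.
Qed.

Lemma pi1_pair x y : pi1 (pair x y) = x.
Proof. by symmetry; rewrite pi1E; exists y; left. Qed.
Lemma pi2_pair x y : pi2 (pair x y) = y.
Proof. by symmetry; rewrite pi2E; exists x; left. Qed.

Lemma dff_pi1 f : dff f -> dff (fun e => pi1 (f e)).
Proof.
apply: dff_app1; apply: dfn_iff; first by move=> e; symmetry; exact: pi1E.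
by rewrite /pair; dfn.
Qed.
Lemma dff_pi2 f : dff f -> dff (fun e => pi2 (f e)).
Proof.
apply: dff_app1; apply: dfn_iff; first by move=> e; symmetry; exact: pi2E.
by rewrite /pair; dfn.
Qed.

(* A number codes an infinite environment by iterated unpairing. *)
Fixpoint dec b (i : nat) : N := if i is j.+1 then dec (pi2 b) j else pi1 b.

Lemma dec_pair x b : dec (pair x b) = scons x (dec b).
Proof.
by apply: functional_extensionality => -[|i] /=; rewrite ?pi1_pair ?pi2_pair.
Qed.

Fixpoint code (n : nat) (e : nat -> N) : N :=
  if n is m.+1 then pair (e 0) (code m (fun i => e i.+1)) else z0.

Lemma dec_code n e i : (i < n)%N -> dec (code n e) i = e i.
Proof.
by elim: n e i => // n IH e [|i] /= h; rewrite ?pi1_pair ?pi2_pair ?IH.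
Qed.

Lemma dff_dec f i : dff f -> dff (fun e => dec (f e) i).
Proof.
by elim: i f => [|i IH] f hf; [exact: dff_pi1|apply: (IH (fun e => pi2 (f e))); exact: dff_pi2].
Qed.

Lemma dff_eval_dec f t : dff f -> dff (fun e => eval (dec (f e)) t).
Proof.
move=> hf; elim: t => [i|||t1 IH1 t2 IH2|t1 IH1 t2 IH2] /=; dfn => //.
exact: dff_dec.
Qed.

(** For one fixed formula this is a recursion in the metatheory, where a quantifier prepends an
    entry to the code by pairing. *)
Lemma dfn_sat_dec f p : dff f -> dfn (fun e => sat (dec (f e)) p).
Proof.
elim: p f => /= [t1 t2|t1 t2||p IHp q IHq|p IHp] f hf; dfn; auto;
  try exact: dff_eval_dec.
apply: (@dfn_iff _ (fun e => sat (dec (pair (e 0) (f (fun i => e i.+1)))) p)).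
  by move=> e; rewrite dec_pair.
apply: IHp; apply: dff_pair; first exact: dff_var.
exact: (dfn_ren (fun i => if i is j.+1 then j.+2 else 0) hf).
Qed.

Lemma eval_finite t : exists n, forall (e e' : nat -> N),
  (forall i, (i < n)%N -> e i = e' i) -> eval e t = eval e' t.
Proof.
elim: t => [i|||t1 [n1 h1] t2 [n2 h2]|t1 [n1 h1] t2 [n2 h2]] /=.
- by exists i.+1 => e e'; apply.
- by exists 0.
- by exists 0.
- exists (maxn n1 n2) => e e' h; rewrite (h1 e e') ?(h2 e e') // => i hi;
  by apply: h; rewrite leq_max hi ?orbT.
- exists (maxn n1 n2) => e e' h; rewrite (h1 e e') ?(h2 e e') // => i hi;
  by apply: h; rewrite leq_max hi ?orbT.
Qed.

Lemma sat_finite p : exists n, forall (e e' : nat -> N),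
  (forall i, (i < n)%N -> e i = e' i) -> sat e p <-> sat e' p.
Proof.
elim: p => [t1 t2|t1 t2||p [n1 h1] q [n2 h2]|p [n h]] /=.
- have [n1 h1] := eval_finite t1; have [n2 h2] := eval_finite t2.
  exists (maxn n1 n2) => e e' h; rewrite (h1 e e') ?(h2 e e') // => i hi;
  by apply: h; rewrite leq_max hi ?orbT.
- have [n1 h1] := eval_finite t1; have [n2 h2] := eval_finite t2.
  exists (maxn n1 n2) => e e' h; rewrite (h1 e e') ?(h2 e e') // => i hi;
  by apply: h; rewrite leq_max hi ?orbT.
- by exists 0.
- exists (maxn n1 n2) => e e' h; rewrite (h1 e e') ?(h2 e e') // => i hi;
  by apply: h; rewrite leq_max hi ?orbT.
- exists n => e e' he; split=> H a; have := H a; apply: (proj1 (h _ _ _)) => -[|i] //= hi;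
  by rewrite he // ltnW.
Qed.

(** Only finitely many of the functions matter to the formula defining [R], and these are packed
    into one code. *)
Lemma dfn_comp (R : (nat -> N) -> Prop) (fs : nat -> (nat -> N) -> N) :
  dfn R -> (forall i, dff (fs i)) -> dfn (fun e => R (fun i => fs i e)).
Proof.
move=> [p Hp] hfs; have [n hn] := sat_finite p.
apply: (@dfn_iff _ (fun e => sat (dec (code n (fun i => fs i e))) p)) => [e|].
  by rewrite -Hp; apply: hn => i; exact: dec_code.
apply: dfn_sat_dec; elim: n {hn} fs hfs => [|n IH] fs hfs /=; first by dfn.
by apply: dff_pair => //; apply: (IH (fun i => fs i.+1)).
Qed.

(** * Elementary substructures and coded sets *)

(* [S] is the universe of an elementary substructure (Tarski-Vaught), tested
   on one parameter only. *)
Definition elem (S : N -> Prop) :=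
  [/\ S z0, (forall x y, S x -> S y -> S (pair x y)) &
   forall P : N -> Prop, dfn (fun e => P (e 0)) -> forall a, S a ->
     (exists x, P (pair x a)) -> exists x, S x /\ P (pair x a)].

(** The finitely many relevant parameters are packed into one code, which lies in [S]; so the test
    on one parameter suffices. *)
Lemma elem_env S (R : N -> (nat -> N) -> Prop) (c : nat -> N) :
  elem S -> dfn (fun e => R (e 0) (fun i => e i.+1)) -> (forall i, S (c i)) ->
  (exists x, R x c) -> exists x, S x /\ R x c.
Proof.
move=> [S0 Sp SP] [p Hp] Sc.
have [n hn] := sat_finite p.
have E x : R x c <-> sat (dec (pair x (code n c))) p.
  have -> : R x c <-> sat (scons x c) p by rewrite Hp.
  apply: hn => -[|i] /= hi; rewrite ?pi1_pair // pi2_pair dec_code //.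
  exact: ltnW.
move=> [x /E Hx].
have [|||x' [Sx' Hx']] := SP (fun b => sat (dec b) p) _ (code n c).
- by apply: dfn_sat_dec; apply: dff_var.
- elim: (n) (c) Sc => //= m IH c' Sc'; apply: Sp => //.
  by apply: IH.
- by exists x.
by exists x'; split=> //; apply/E.
Qed.

Lemma elem_all : elem (fun _ => True).
Proof. by split=> // P hP a _ [x Hx]; exists x. Qed.

(* Goedel's coding: [pair c m] codes the set of [k] such that [1 + (k + 1) m]
   divides [c]. *)
Definition mem k s := exists c m q, s = pair c m /\ c = q * (z1 + (k + z1) * m).

Lemma dfn_mem f g : dff f -> dff g -> dfn (fun e => mem (f e) (g e)).
Proof.
by apply: (@dfn_app2 _ (fun k s => mem k s)); rewrite /mem /pair; dfn.
Qed.

Ltac pa_dfn := cbv beta; repeat first [ dfn_step | lazymatch goal with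
  | |- dfn (fun e => mem _ _) => apply: dfn_mem
  | |- dff (fun e => pair _ _) => apply: dff_pair
  | |- dff (fun e => pi1 _) => apply: dff_pi1
  | |- dff (fun e => pi2 _) => apply: dff_pi2
  end
  | match goal with
  | H : dfn (fun e => ?P (e 0)) |- dfn (fun e => ?P _) => apply: (dfn_app1 H)
  | H : dfn (fun e => ?P (e 0) (e 1)) |- dfn (fun e => ?P _ _) => apply: (dfn_app2 H)
  | H : dfn (fun e => e 0 = ?F (e 1)) |- dff (fun e => ?F _) => apply: (dff_app1 H)
  end ].

Lemma mem_pair k c m : mem k (pair c m) <-> exists q, c = q * (z1 + (k + z1) * m).
Proof.
split=> [[c' [m' [q [/pair_inj [-> ->] ->]]]]|[q ->]]; first by exists q.
by exists (q * (z1 + (k + z1) * m)), m, q.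
Qed.

Lemma mul_cancel u a b c : a * u + c = b * u -> exists t, t * u = c.
Proof.
move=> H; case: (le_total a b); rewrite leE => -[t Et].
  by exists t; apply: (@addxI (a * u)); rewrite H -Et; ring.
have [] : t * u = z0 /\ c = z0; last by move=> _ ->; exists z0; ring.
by apply: add_eq0; apply: (@addxI (b * u)); rewrite addx0 -{2}H -Et; ring.
Qed.

(* If every difference of two indices divides [m], the moduli [1 + (i + 1) m]
   are pairwise coprime: with [w = (i + 1) m] one has [w^2 = 1] modulo [w + 1],
   which makes [m], and hence each of its divisors, invertible. *)
Lemma modulus_coprime m i k c q : m <> z0 ->
  (exists d, m = d * q /\ (i + d = k \/ k + d = i)) ->
  (exists t, c * (z1 + (k + z1) * m) = t * (z1 + (i + z1) * m)) ->
  exists t, c = t * (z1 + (i + z1) * m).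
Proof.
move=> m0 [d [Em Ed]] [t Et].
have [w Ew] : exists w, (i + z1) * m = w + z1.
  case: (zero_or_succ m) => // -[m' ->].
  by exists ((i + z1) * m' + i); ring.
have Ew2 : (i + z1) * m * ((i + z1) * m) = w * (z1 + (i + z1) * m) + z1.
  by rewrite !Ew; ring.
(* Multiplication by [q * (i + z1) * (i + z1)] turns the difference [d * m] of the moduli into the
   square of [(i + z1) * m]. The two cases differ in the side on which terms are collected, as there
   is no subtraction. *)
case: Ed => Ed; symmetry in Ed.
- have [s Es] : exists s, s * (z1 + (i + z1) * m) = c; last by exists s.
  apply: (@mul_cancel _ (c * (q * (i + z1) * (i + z1) + w)) (t * (q * (i + z1) * (i + z1)))).
  have -> : t * (q * (i + z1) * (i + z1)) * (z1 + (i + z1) * m) =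
    c * (z1 + (k + z1) * m) * (q * (i + z1) * (i + z1)) by rewrite Et; ring.
  have -> : c * (z1 + (k + z1) * m) * (q * (i + z1) * (i + z1)) =
     c * (z1 + (i + z1) * m) * (q * (i + z1) * (i + z1)) +
     c * ((d * q * (i + z1)) * (m * (i + z1))) by rewrite Ed; ring.
  have -> : (d * q * (i + z1)) * (m * (i + z1)) = w * (z1 + (i + z1) * m) + z1.
    by rewrite -Em -Ew2; ring.
  ring.
- have [s Es] : exists s, s * (z1 + (i + z1) * m) = c; last by exists s.
  apply: (@mul_cancel _ (t * (q * (i + z1) * (i + z1)) + c * w) (c * (q * (i + z1) * (i + z1)))).
  have -> : (t * (q * (i + z1) * (i + z1)) + c * w) * (z1 + (i + z1) * m) =
    c * (z1 + (k + z1) * m) * (q * (i + z1) * (i + z1)) + c * w * (z1 + (i + z1) * m)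
    by rewrite Et; ring.
  have -> : c * (q * (i + z1) * (i + z1)) * (z1 + (i + z1) * m) =
     c * (z1 + (k + z1) * m) * (q * (i + z1) * (i + z1)) +
     c * ((d * q * (i + z1)) * (m * (i + z1))) by rewrite {3}Ed; ring.
  have -> : (d * q * (i + z1)) * (m * (i + z1)) = w * (z1 + (i + z1) * m) + z1.
    by rewrite -Em -Ew2; ring.
  ring.
Qed.

(** The induction builds the factorial of [a]. *)
Lemma common_multiple a :
  exists m, m <> z0 /\ forall d, d <> z0 -> d <= a -> exists q, m = d * q.
Proof.
move: a; apply: PA_ind; first by dfn.
- exists z1; split; first by move=> H; apply: (@addS_neq0 z0); rewrite add0x.
  by move=> d d0 hd; case: d0; apply: le_anti => //; exact: le0x.
- move=> a [m [m0 H]]; exists (m * (a + z1)); split.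
    by rewrite mulxS => /add_eq0 [].
  move=> d d0; rewrite le_succ => -[/(H d d0) [q ->]|->].
    by exists (q * (a + z1)); ring.
  by exists m; ring.
Qed.

(** Distinct indices up to [a] differ by divisors of [m], so their moduli are coprime; the code is
    the product of the moduli of the members, built one index at a time. *)
Lemma comprehension (R : N -> (nat -> N) -> Prop) (c : nat -> N) a :
  dfn (fun e => R (e 0) (fun i => e i.+1)) ->
  exists s, forall k, k <= a -> (mem k s <-> R k c).
Proof.
move=> hR; have [m [m0 Hm]] := common_multiple a.
have C i k : i <= a -> k <= a -> i <> k -> exists d q, m = d * q /\ (i + d = k \/ k + d = i).
  move=> hi hk nik; case: (le_total i k); rewrite leE => -[d Ed].
    have [||q Eq] := Hm d; last by exists d, q; auto.
      by move=> d0; apply: nik; rewrite -Ed d0 addx0.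
    by apply: le_trans hk; rewrite -Ed; exact: le_addl.
  have [||q Eq] := Hm d; last by exists d, q; auto.
    by move=> d0; apply: nik; rewrite -Ed d0 addx0.
  by apply: le_trans hi; rewrite -Ed; exact: le_addl.
suff H : forall b, b <= a + z1 -> exists s, forall k, k <= a ->
    ((exists q, s = q * (z1 + (k + z1) * m)) <-> R k c /\ k + z1 <= b).
  have [s Hs] := H _ (lexx _); exists (pair s m) => k hk.
  rewrite mem_pair (Hs k hk); split=> [[]//|Rk]; split=> //.
  by apply: le_add => //; exact: lexx.
pose e := scons a (scons m c).
apply: (@PA_ind_env (fun b e => b <= e 0 + z1 -> exists s, forall k, k <= e 0 ->
    ((exists q, s = q * (z1 + (k + z1) * e 1)) <->
     R k (fun i => e i.+2) /\ k + z1 <= b)) e).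
- dfn; exact: (dfn_ren (fun i => if i is j.+1 then j.+4.+1 else 0) hR).
(* No modulus divides the empty product, since [m] is nonzero and so every modulus exceeds one. *)
- move=> _; exists z1 => k hk; split=> [[q Hq]|[_ h]].
    have H : q * (z1 + (k + z1) * m) = z0 + z1 by rewrite add0x -Hq.
    case: (zero_or_succ q) H => [->|[q' ->]]; first by rewrite mul0x => H; case: (@addS_neq0 z0).
    have -> : (q' + z1) * (z1 + (k + z1) * m) =
       q' + q' * k * m + q' * m + k * m + m + z1 by ring.
    by move/addSI => /add_eq0 [_ /m0].
  by have := le_anti h (le0x _); move/addS_neq0.
- move=> b IH hb.
  have hb' : b <= a by case: (le_lt_total b a) => // h; have := le_trans hb h => /succ_le_irr.
  case: IH; first by apply: le_trans hb' (le_addr _ _).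
  move=> s Hs.
  have E k : k + z1 <= b + z1 <-> k + z1 <= b \/ k = b.
    by rewrite le_succ; split=> -[]; auto; [move/addSI; auto|move=> ->; auto].
  case: (classic (R b c)) => Rb; last first.
    exists s => k hk; rewrite (Hs k hk) E; split=> -[Rk h]; split=> //; first by left.
    by case: h => // ?; subst k.
  exists (s * (z1 + (b + z1) * m)) => k hk; rewrite E.
  case: (classic (k = b)) => [->|nkb].
    by split=> [_|_]; [split=> //; right|exists s].
  have [d [q Edq]] := C k b hk hb' nkb; have := Hs k hk; rewrite /e /= => {}Hs.
  split=> [h|[Rk [h|//]]].
    case: (proj1 Hs); last by auto.
    by apply: (@modulus_coprime m k b s q) => //; exists d.
  by case: (proj2 Hs (conj Rk h)) => t ->; exists (t * (z1 + (b + z1) * m)); ring.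
Qed.

(** By induction on the length of the interval: a set on the longer interval is given by a bounded
    code and one more bit, and collection bounds the codes of all these extensions. *)
Lemma bounded_codes w :
  exists W, forall s, exists s', s' <= W /\ forall k, k <= w -> (mem k s' <-> mem k s).
Proof.
suff [W HW] : exists W, forall s, exists s', s' <= W /\
    forall k, k + z1 <= w + z1 -> (mem k s' <-> mem k s).
  exists W => s; have [s' [h1 h2]] := HW s; exists s'; split=> // k hk; apply: h2.
  by apply: le_add => //; exact: lexx.
(* With a strict bound the induction starts from the empty interval. *)
move: (w + z1) => {}w; move: w; apply: PA_ind; first by pa_dfn.
- exists z0 => s; exists z0; split; first exact: lexx.
  by move=> k h; have := le_anti h (le0x _) => /addS_neq0.
- move=> w [W HW].
  (* Here [x] pairs an old code with the bit telling whether [w] is to be a member. *)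
  have [b Hb] := @collection (fun x y c => forall k, k + z1 <= c 0 + z1 ->
      (mem k y <-> mem k (pi1 x) /\ k + z1 <= c 0 \/ pi2 x = z1 /\ k = c 0))
    (fun _ => w) (pair W z1) ltac:(pa_dfn).
  have E k : k + z1 <= w + z1 <-> k + z1 <= w \/ k = w.
    by rewrite le_succ; split=> -[]; auto; [move/addSI; auto|move=> ->; auto].
  exists b => s; have [s1 [h1 h2]] := HW s.
  have [t [ht Et]] : exists t, t <= z1 /\ (t = z1 <-> mem w s).
    case: (classic (mem w s)) => h; first by exists z1; split=> //; exact: lexx.
    exists z0; split; first exact: le0x.
    by split=> // H; case: (@addS_neq0 z0); rewrite add0x.
  have [||s' [h3 h4]] := Hb (pair s1 t).
  + exact: le_pair.
  + have [s' Hs'] := @comprehension (fun k c =>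
      mem k (c 0) /\ k + z1 <= c 1 \/ c 2 = z1 /\ k = c 1) (nth z0 [:: s1; w; t]) w ltac:(pa_dfn).
    exists s' => k hk /=; rewrite pi1_pair pi2_pair; apply: Hs'.
    case: (le_lt_total k w) => // h.
    by have := le_trans (le_add h (lexx z1)) hk => /succ_le_irr.
  + exists s'; split=> // k hk; rewrite (h4 k hk) pi1_pair pi2_pair Et.
    move: hk; rewrite E => -[hk|->].
      rewrite (h2 k hk); split=> [[[]//|[h Ek]]|]; auto.
      by move: hk; rewrite Ek => /succ_le_irr.
    split=> [[[_ /succ_le_irr]|[]]|] //; by auto.
Qed.

(** * Closure properties, generated substructures, joins and downward closures *)

Lemma elem_uniq S (R : N -> (nat -> N) -> Prop) (c : nat -> N) y :
  elem S -> dfn (fun e => R (e 0) (fun i => e i.+1)) -> (forall i, S (c i)) ->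
  R y c -> (forall y', R y' c -> y' = y) -> S y.
Proof.
move=> eS dR Sc Ry uy; have [|y' [Sy' /uy <-]] // := elem_env eS dR Sc.
by exists y.
Qed.

Lemma all_nth (S : N -> Prop) x0 (s : seq N) :
  S x0 -> foldr (fun x P => S x /\ P) True s -> forall i, S (nth x0 s i).
Proof. by move=> Sx0; elim: s => [|x s IH] /= => [_ []//|[Sx /IH h] []]. Qed.

Section ElemClosure.
Variables (S : N -> Prop) (eS : elem S).
Lemma elem0 : S z0. Proof. by case: eS. Qed.
Lemma elem_pair x y : S x -> S y -> S (pair x y).
Proof. by case: eS => _ h _; exact: h. Qed.
Lemma elem_fun1 (F : N -> N) x : dfn (fun e => e 0 = F (e 1)) -> S x -> S (F x).
Proof.
move=> dF Sx; apply: (@elem_uniq S (fun y c => y = F (c 0)) (fun _ => x)) => //.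
Qed.
Lemma elem_fun2 (F : N -> N -> N) x y :
  dfn (fun e => e 0 = F (e 1) (e 2)) -> S x -> S y -> S (F x y).
Proof.
move=> dF Sx Sy; apply: (@elem_uniq S (fun y c => y = F (c 0) (c 1)) (nth z0 [:: x; y])) => //.
by apply: all_nth; first exact: elem0.
Qed.
Lemma elem1 : S z1.
Proof.
by apply: (@elem_uniq S (fun y c => y = z1) (fun _ => z0)) => //; [dfn|move=> _; exact: elem0].
Qed.
Lemma elem_add x y : S x -> S y -> S (x + y).
Proof. by apply: (@elem_fun2 (fun x y => x + y)); dfn. Qed.
Lemma elem_mul x y : S x -> S y -> S (x * y).
Proof. by apply: (@elem_fun2 (fun x y => x * y)); dfn. Qed.
Lemma elem_pi1 x : S x -> S (pi1 x).
Proof. by apply: (@elem_fun1 pi1); pa_dfn. Qed.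
Lemma elem_pi2 x : S x -> S (pi2 x).
Proof. by apply: (@elem_fun1 pi2); pa_dfn. Qed.
End ElemClosure.

(** The least witness is definable from the parameter, hence common to both. *)
Lemma elem_inter S S' : elem S -> elem S' -> elem (fun x => S x /\ S' x).
Proof.
move=> eS eS'; split.
- by split; exact: elem0.
- by move=> x y [? ?] [? ?]; split; exact: elem_pair.
- move=> P dP a [Sa Sa'] exP.
  have dR : dfn (fun e => P (pair (e 0) (e 1)) /\
      forall y, P (pair y (e 1)) -> e 0 <= y) by pa_dfn.
  have [x [Px xmin]] := @least_env (fun x c => P (pair x (c 0))) (fun _ => a)
    ltac:(pa_dfn) exP.
  exists x; split=> //; split;
    apply: (@elem_uniq _ (fun x c => P (pair x (c 0)) /\
      forall y, P (pair y (c 0)) -> x <= y) (fun _ => a)) => // y [Py ymin];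
    by apply: le_anti; auto.
Qed.

(** The definable closure of [t]. As least witnesses act as Skolem functions, it is the elementary
    substructure generated by [t]. *)
Definition dcl t y := exists P : N -> Prop, [/\ dfn (fun e => P (e 0)),
  P (pair y t) & forall y', P (pair y' t) -> y' = y].

Lemma dcl_refl t : dcl t t.
Proof.
exists (fun b => pi1 b = pi2 b); rewrite !pi1_pair !pi2_pair; split=> //; first by pa_dfn.
by move=> y'; rewrite !pi1_pair !pi2_pair.
Qed.

Lemma elem_dcl t : elem (dcl t).
Proof.
split.
- exists (fun b => pi1 b = z0); rewrite pi1_pair; split=> //; first by pa_dfn.
  by move=> y'; rewrite pi1_pair.
- move=> x y [P [dP Px Pu]] [Q [dQ Qy Qu]].
  exists (fun b => exists x y, [/\ pi1 b = pair x y, P (pair x (pi2 b)) & Q (pair y (pi2 b))]).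
  split; first by apply: (@dfn_iff _ (fun e => exists x y, pi1 (e 0) = pair x y /\
      (P (pair x (pi2 (e 0))) /\ Q (pair y (pi2 (e 0)))))); [firstorder|pa_dfn].
  + by exists x, y; rewrite pi1_pair pi2_pair.
  + by move=> w [x' [y' []]]; rewrite pi1_pair pi2_pair => -> /Pu -> /Qu ->.
- move=> Q dQ a [P [dP Pa Pu]] exQ.
  have [x [Qx hx]] := @least_env (fun x c => Q (pair x (c 0))) (fun _ => a) ltac:(pa_dfn) exQ.
  exists x; split=> //.
  exists (fun b => exists a, P (pair a (pi2 b)) /\ (Q (pair (pi1 b) a) /\
    forall x', Q (pair x' a) -> pi1 b <= x')); split; first by pa_dfn.
  + by exists a; rewrite pi1_pair pi2_pair.
  + move=> y [a' []]; rewrite pi1_pair pi2_pair => /Pu -> [Qy hy].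
    by apply: le_anti; [exact: hy|exact: hx].
Qed.

Lemma dcl_sub S t y : elem S -> S t -> dcl t y -> S y.
Proof.
move=> eS St [P [dP Py Pu]].
by apply: (@elem_uniq S (fun y c => P (pair y (c 0))) (fun _ => t)) => //; pa_dfn.
Qed.

(** One parameter from each side suffices because both sides are closed under pairing. *)
Definition join (A C : N -> Prop) y := exists a c, [/\ A a, C c & dcl (pair a c) y].

Lemma joinl A C a : elem C -> A a -> join A C a.
Proof.
move=> eC Aa; exists a, z0; split=> //; first exact: elem0.
by have := elem_pi1 (elem_dcl _) (dcl_refl (pair a z0)); rewrite pi1_pair.
Qed.

Lemma joinr A C c : elem A -> C c -> join A C c.
Proof.
move=> eA Cc; exists z0, c; split=> //; first exact: elem0.
by have := elem_pi2 (elem_dcl _) (dcl_refl (pair z0 c)); rewrite pi2_pair.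
Qed.

Lemma join_sub A C S : elem S -> (forall x, A x -> S x) -> (forall x, C x -> S x) ->
  forall x, join A C x -> S x.
Proof.
move=> eS AS CS x [a [c [Aa Cc]]]; apply: dcl_sub => //.
by apply: elem_pair; auto.
Qed.

Lemma elem_join A C : elem A -> elem C -> elem (join A C).
Proof.
move=> eA eC; split; first by apply: joinl => //; exact: elem0.
- move=> x y [a [c [Aa Cc hx]]] [a' [c' [Aa' Cc' hy]]].
  exists (pair a a'), (pair c c'); split; try exact: elem_pair.
  set t := pair _ _; have et := elem_dcl t.
  have ht := dcl_refl t; have h1 := elem_pi1 et ht; have h2 := elem_pi2 et ht.
  have h11 := elem_pi1 et h1; have h12 := elem_pi2 et h1.
  have h21 := elem_pi1 et h2; have h22 := elem_pi2 et h2.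
  rewrite {}/t !(pi1_pair, pi2_pair) in et ht h1 h2 h11 h12 h21 h22 *.
  by apply: (elem_pair et); [apply: (dcl_sub et _ hx)|apply: (dcl_sub et _ hy)];
    apply: (elem_pair et).
- move=> P dP a [b [c [Ab Cc h]]] exP.
  have [x [hx Px]] := elem_env (elem_dcl (pair b c)) (R := fun x c => P (pair x (c 0)))
    (c := fun _ => a) ltac:(pa_dfn) (fun _ => h) exP.
  by exists x; split=> //; exists b, c.
Qed.

Lemma join_dcl A z y : elem A -> join A (dcl z) y -> exists e, A e /\ dcl (pair e z) y.
Proof.
move=> eA [e [u [Ae zu h]]]; exists e; split=> //.
have et := elem_dcl (pair e z); have ht := dcl_refl (pair e z).
have h1 := elem_pi1 et ht; have h2 := elem_pi2 et ht.
rewrite pi1_pair in h1; rewrite pi2_pair in h2.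
by apply: (dcl_sub et _ h); apply: (elem_pair et) => //; apply: (dcl_sub et h2).
Qed.

(** For the base model this is the set called K in the overview. *)
Definition down (M : N -> Prop) x := exists m, M m /\ x <= m.

Lemma sub_down M x : M x -> down M x.
Proof. by move=> Mx; exists x; split=> //; exact: lexx. Qed.

Lemma down_le M x y : x <= y -> down M y -> down M x.
Proof. by move=> h [m [Mm hm]]; exists m; split=> //; apply: le_trans hm. Qed.

(** Collection bounds witnesses for all parameters up to [m] at once, and elementarity puts such a
    bound in [M]. *)
Lemma elem_down M : elem M -> elem (down M).
Proof.
move=> eM; split; first by apply: sub_down; exact: elem0.
- move=> x y [m [Mm hm]] [m' [Mm' hm']]; exists (pair m m').
  by split; [exact: elem_pair|exact: le_pair].
- move=> P dP a [m [Mm ham]] exP.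
  have [b [Mb hb]] := elem_env eM (R := fun b c => forall x, x <= c 0 ->
      (exists y, P (pair y x)) -> exists y, y <= b /\ P (pair y x))
    (c := fun _ => m) ltac:(pa_dfn) (fun _ => Mm)
    (@collection (fun x y _ => P (pair y x)) (fun _ => z0) m ltac:(pa_dfn)).
  have [x [hx Px]] := hb a ham exP.
  by exists x; split=> //; exists b.
Qed.

(* The parameter [k] from [down M] in a definition of an element of [B] over
   [join A (down M)] can be found again in [B], hence in [M]. *)
Lemma join_down_trivial M A B : elem M -> elem A -> elem B ->
  (forall x, M x -> A x) -> (forall x, A x -> B x) ->
  (forall x, down M x -> B x -> M x) -> (forall x, join A (down M) x) ->
  forall x, B x -> A x.
Proof.
move=> eM eA eB MA AB KB hj b Bb.
have [a [k [Aa [m [Mm hkm]] [P [dP Pb Pu]]]]] := hj b.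
have [|||k' [Bk' [hk'm [Pk' uk']]]] := elem_env eB (R := fun k c => k <= c 0 /\
    (P (pair (c 1) (pair (c 2) k)) /\ forall y, P (pair y (pair (c 2) k)) -> y = c 1))
  (c := nth z0 [:: m; b; a]); first by pa_dfn.
- by apply: all_nth; [exact: elem0|move=> /=; auto].
- by exists k.
have Mk' : M k' by apply: KB => //; exists m.
apply: (@dcl_sub A (pair a k')) => //; first by apply: elem_pair; auto.
by exists P.
Qed.

(* A relation definable over [c], cut down to an interval bounded in [M], has a
   code bounded in [M]; a code found in [C] therefore lies in [M]. *)
Lemma join_within_down_trivial M A C : elem M -> elem A -> elem C ->
  (forall x, M x -> A x) -> (forall x, M x -> C x) -> (forall x, A x -> down M x) ->
  (forall x, down M x -> C x -> M x) -> (forall x, join A C x) ->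
  forall x, down M x -> A x.
Proof.
move=> eM eA eC MA MC AK KC hj x [mx [Mmx hx]].
have [a [c [Aa Cc [P [dP Px Pu]]]]] := hj x.
have [ma [Mma ha]] := AK a Aa.
pose w := pair mx ma; have Mw : M w by apply: elem_pair.
have [W [MW hW]] := elem_env eM (R := fun W c => forall s, exists s', s' <= W /\
    forall k, k <= c 0 -> (mem k s' <-> mem k s))
  (c := fun _ => w) ltac:(pa_dfn) (fun _ => Mw) (bounded_codes w).
(* The graph of the partial function that [P] defines from [c]: the first projection is the value at
   the second. *)
pose G k c := P (pair (pi1 k) (pair (pi2 k) c)) /\
  forall y, P (pair y (pair (pi2 k) c)) -> y = pi1 k.
have [s hs] := @comprehension (fun k e => G k (e 0)) (fun _ => c) w ltac:(rewrite /G; pa_dfn).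
have [||s1 [Cs1 [hs1 hs1G]]] := elem_env eC (R := fun s e => s <= e 0 /\
    forall k, k <= e 1 -> (mem k s <-> G k (e 2)))
  (c := nth z0 [:: W; w; c]) ltac:(rewrite /G; pa_dfn).
- by apply: all_nth; [exact: elem0|move=> /=; auto].
- by have [s' [h1 h2]] := hW s; exists s'; split=> // k hk; rewrite -hs ?h2.
have Ms1 : M s1 by apply: KC => //; exists W.
apply: (@elem_uniq A (fun x e => x <= e 0 /\ mem (pair x (e 1)) (e 2))
  (nth z0 [:: mx; a; s1])) => //; first by pa_dfn.
- by apply: all_nth; [exact: elem0|move=> /=; auto].
- split=> //=; apply/hs1G; first exact: le_pair.
  by rewrite /= /G pi1_pair pi2_pair.
- move=> y /= [hy]; rewrite hs1G; last exact: le_pair.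
  by rewrite /G pi1_pair pi2_pair => -[/Pu].
Qed.

(** * A coded family of sets closed under the logical operations *)

Fixpoint num (k : nat) : N := if k is j.+1 then num j + z1 else z0.

Lemma num_inj j k : num j = num k -> j = k.
Proof.
elim: j k => [|j IH] [|k] //= => [/esym/addS_neq0|/addS_neq0|/addSI/IH ->] //.
Qed.

Lemma dff_num k : dff (fun e : nat -> N => num k).
Proof. by elim: k => [|k IH] /=; dfn. Qed.

Lemma elem_num S k : elem S -> S (num k).
Proof. by move=> eS; elim: k => [|k IH] /=; [exact: elem0|apply: elem_add => //; exact: elem1]. Qed.

(** Since [k] is a standard number, this is a finite disjunction. *)
Lemma dfn_ex_ltn (P : nat -> (nat -> N) -> Prop) n :
  (forall k, dfn (P k)) -> dfn (fun e => exists2 k, (k < n)%N & P k e).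
Proof.
move=> dP; elim: n => [|n IH].
  by apply: (@dfn_iff _ (fun _ => False)); [move=> e; split=> // -[]|dfn].
apply: (@dfn_iff _ (fun e => (exists2 k, (k < n)%N & P k e) \/ P n e)); last by dfn.
move=> e; split=> [[[k kn Pk]|Pn]|[k]].
- by exists k => //; apply: ltnW.
- by exists n.
- by rewrite ltnS leq_eqVlt => /orP[/eqP -> //|kn Pk]; [right|left; exists k].
Qed.

(* One step of a recursive truth definition. A number [a] stands for the
   environment [dec a]; [I] and [J] are the sets attached to the immediate
   subexpressions, a term [t] being represented by the graph of its value, as a
   relation between [pi1 a] and the environment [pi2 a]. Quantifiers range over
   the witnesses [u] for which the extended code [pair u a] is in [S]. *)
Definition clause (k : nat) (I J S : N -> Prop) (a : N) : Prop :=
  match k with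
  | 0 => pi1 a = pi1 (pi2 a)
  | 1 => I (pair (pi1 a) (pi2 (pi2 a)))
  | 2 => pi1 a = z0
  | 3 => pi1 a = z1
  | 4 => exists u v, (S (pair u (pi2 a)) /\ S (pair v (pi2 a))) /\
      (I (pair u (pi2 a)) /\ J (pair v (pi2 a))) /\ pi1 a = u + v
  | 5 => exists u v, (S (pair u (pi2 a)) /\ S (pair v (pi2 a))) /\
      (I (pair u (pi2 a)) /\ J (pair v (pi2 a))) /\ pi1 a = u * v
  | 6 => exists u v, (S (pair u a) /\ S (pair v a)) /\
      (I (pair u a) /\ J (pair v a)) /\ u = v
  | 7 => exists u v, (S (pair u a) /\ S (pair v a)) /\
      (I (pair u a) /\ J (pair v a)) /\ u <= v
  | 8 => I a -> J a
  | 9 => forall u, S (pair u a) -> I (pair u a)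
  | _ => False
  end.

(* The successor makes the indices [l] and [r] of the subexpressions strictly
   smaller than the index of the expression. *)
Definition idx k l r v := pair (num k) (pair l (pair r v)) + z1.

Lemma idx_inj k l r v k' l' r' v' : idx k l r v = idx k' l' r' v' ->
  [/\ k = k', l = l', r = r' & v = v'].
Proof. by move/addSI/pair_inj => [/num_inj -> /pair_inj [-> /pair_inj [-> ->]]]. Qed.

Lemma idx_gt k l r v : l + z1 <= idx k l r v /\ r + z1 <= idx k l r v.
Proof.
split; apply: le_add; try exact: lexx.
  exact: le_trans (le_pair1 _ _) (le_pair2 _ _).
exact: le_trans (le_trans (le_pair1 _ _) (le_pair2 _ _)) (le_pair2 _ _).
Qed.

(** * Recursive construction of the coded family *)

Section Family.
Variables (T : N -> N -> N -> Prop) (c d : N).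
Hypothesis dT : dfn (fun e => T (e 0) (e 1) (e 2)).

(* [T v s c] says that [s] is the bound with index [v]. *)
Definition small c d v b := b <= d /\ exists s, T v s c /\ b <= s.
Definition below d p l b := b <= d /\ mem (pair l b) p.
(** The value [k = 10] stands for the false formula, and a number not of the form [idx k l r v]
    indexes the empty set. *)
Definition step c d p i a := exists l r v, exists2 k, (k < 11)%N &
  i = idx k l r v /\ clause k (below d p l) (below d p r) (small c d v) a.

Lemma dfn_step c' d' p i a : dff c' -> dff d' -> dff p -> dff i -> dff a ->
  dfn (fun e => step (c' e) (d' e) (p e) (i e) (a e)).
Proof.
move=> hc hd hp hi ha.
have base : dfn (fun e => step (e 0) (e 1) (e 2) (e 3) (e 4)).
  rewrite /step; do 3 (apply: dfn_ex; cbv beta).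
  apply: dfn_ex_ltn => k; apply: dfn_and.
    rewrite /idx; pa_dfn; apply: dff_num.
  move: k; do 11 (case; [rewrite /= /below /small; pa_dfn; apply: (dfn_app3 dT); pa_dfn|]).
  move=> k /=; dfn.
apply: (dfn_comp (fs := nth (fun _ => z0) [:: c'; d'; p; i; a]) base).
by do 5 (case; first by []); move=> m; rewrite /= nth_nil; exact: dff_zero.
Qed.

Lemma stepE p k l r v a : (k < 11)%N -> step c d p (idx k l r v) a <->
  clause k (below d p l) (below d p r) (small c d v) a.
Proof.
move=> hk; split=> [[l' [r' [v' [k' _ [/idx_inj [-> -> -> ->]]]]]]//|h].
by exists l, r, v, k.
Qed.

Lemma step_congr p p' i a :
  (forall l b, l + z1 <= i -> b <= d -> mem (pair l b) p <-> mem (pair l b) p') ->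
  step c d p i a <-> step c d p' i a.
Proof.
move=> h.
have E l : l + z1 <= i -> below d p l = below d p' l.
  move=> hl; apply: functional_extensionality => b; apply: propositional_extensionality.
  by split=> -[hb]; have := h l b hl hb; rewrite /below; tauto.
split=> -[l [r [v [k hk [Ei]]]]]; have [h1 h2] := idx_gt k l r v; rewrite -Ei in h1 h2.
  by rewrite !E // => H; exists l, r, v, k.
by rewrite -!E // => H; exists l, r, v, k.
Qed.

(** By induction on a bound [L] for the indices, comprehension copies the earlier rows and adds row
    [L]. This is consistent by [step_congr], as a row depends on rows of smaller index only. *)
Lemma family : exists p, forall i a, i <= d -> a <= d ->
  (mem (pair i a) p <-> step c d p i a).
Proof.
suff H : forall L, exists p, forall i a, i + z1 <= L -> a <= d ->
    (mem (pair i a) p <-> step c d p i a).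
  have [p hp] := H (d + z1); exists p => i a hi; apply: hp.
  by apply: le_add => //; exact: lexx.
apply: (@PA_ind2 (fun L c d => exists p, forall i a, i + z1 <= L -> a <= d ->
    (mem (pair i a) p <-> step c d p i a))); first by pa_dfn; apply: dfn_step; dfn.
- by exists z0 => i a h; have := le_anti h (le0x _) => /addS_neq0.
- move=> L [p hp].
  have [p' hp'] := @comprehension (fun k e => pi1 k + z1 <= e 0 /\ mem k (e 1) \/
      pi1 k = e 0 /\ step (e 2) (e 3) (e 1) (e 0) (pi2 k)) (nth z0 [:: L; p; c; d])
    (pair L d) ltac:(pa_dfn; apply: dfn_step; pa_dfn).
  have E l b : l <= L -> b <= d -> mem (pair l b) p' <->
      l + z1 <= L /\ mem (pair l b) p \/ l = L /\ step c d p L b.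
    by move=> hl hb; rewrite hp' ?pi1_pair ?pi2_pair //; exact: le_pair.
  have C i a : i <= L -> step c d p i a <-> step c d p' i a.
    move=> hi; apply: step_congr => l b hl hb.
    have hlL := le_trans hl hi; rewrite E //; last by apply: le_trans hlL; exact: le_addr.
    split=> [|[[]//|[El]]]; first by left.
    by move: hlL; rewrite El => /succ_le_irr.
  exists p' => i a; rewrite le_succ => -[hi|/addSI ->] ha.
    have hiL : i <= L by apply: le_trans hi; exact: le_addr.
    rewrite -C // E // -(hp i a) //; split=> [[[]//|[Ei]]|]; last by left.
    by move: hi; rewrite Ei => /succ_le_irr.
  rewrite -C ?E //; try exact: lexx.
  by split=> [[[/succ_le_irr]|[]]|] //; right.
Qed.
End Family.
(** * A cofinal extension followed by an end extension *)

Lemma least_choice (R : N -> N -> Prop) : dfn (fun e => R (e 0) (e 1)) ->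
  (forall x, exists y, R x y) -> exists F : N -> N,
    [/\ dfn (fun e => e 0 = F (e 1)), forall x, R x (F x) &
        forall x y, R x y -> F x <= y].
Proof.
move=> dR exR.
have ex x : exists y, R x y /\ forall y', R x y' -> y <= y'.
  by apply: (@least_env (fun y c => R (c 0) y) (fun _ => x)) => //; pa_dfn.
pose F x := epsilon (inhabits z0) (fun y => R x y /\ forall y', R x y' -> y <= y').
have hF x : R x (F x) /\ forall y', R x y' -> F x <= y' := epsilon_spec (inhabits z0) _ (ex x).
exists F; split; [|by move=> x; case: (hF x)|by move=> x; case: (hF x)].
apply: (@dfn_iff _ (fun e => R (e 1) (e 0) /\ forall y', R (e 1) y' -> e 0 <= y')).
  move=> e; split=> [[h1 h2]|->]; last exact: hF.
  by case: (hF (e 1)) => h3 h4; apply: le_anti; auto.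
by pa_dfn.
Qed.

Definition growing (F : N -> N) := [/\ dfn (fun e => e 0 = F (e 1)),
  forall x, x + z1 <= F x & forall x y, x <= y -> F x <= F y].

(** Collection bounds the values of the partial function given by [P] on arguments up to [x]. Taking
    the least bound above [x] makes [F] monotone, as a bound for a larger argument also serves a
    smaller one. *)
Lemma dominating (P : N -> Prop) : dfn (fun e => P (e 0)) ->
  exists F, growing F /\ forall x t t' v, t <= x -> t' <= x ->
    P (pair v (pair t t')) -> (forall v', P (pair v' (pair t t')) -> v' = v) -> v <= F x.
Proof.
move=> dP.
pose R x y := x + z1 <= y /\ forall t t' v, t <= x -> t' <= x ->
  P (pair v (pair t t')) -> (forall v', P (pair v' (pair t t')) -> v' = v) -> v <= y.
have [||F [dF RF Fmin]] := @least_choice R; first by rewrite /R; pa_dfn.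
  move=> x.
  have [b Hb] := @collection (fun a v _ => P (pair v a) /\ forall v', P (pair v' a) -> v' = v)
    (fun _ => z0) (pair x x) ltac:(pa_dfn).
  exists (x + z1 + b); split; first exact: le_addr.
  move=> t t' v ht ht' Pv Pu.
  have [||v' [hv' [Pv' _]]] := Hb (pair t t'); [exact: le_pair|by exists v|].
  by rewrite -(Pu _ Pv'); apply: le_trans hv' (le_addl _ _).
exists F; split; last by move=> x; case: (RF x).
split=> // [x|x y hxy]; first by case: (RF x).
apply: Fmin; case: (RF y) => h1 h2; split.
  by apply: le_trans h1; apply: le_add => //; exact: lexx.
by move=> t t' v ht ht'; apply: h2; [apply: le_trans hxy|apply: le_trans hxy].
Qed.

(* The iterates of [F] at zero, as the least set containing zero that is closed
   under [F] up to a given bound. *)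
Lemma iterates F : growing F -> exists X : N -> Prop,
  [/\ dfn (fun e => X (e 0)), X z0, forall x, X x -> X (F x) &
      forall x y, X x -> X y -> x + z1 <= y -> F x <= y].
Proof.
move=> [dF Fgt Fmono].
pose X x := forall s, mem z0 s ->
  (forall y, mem y s -> F y <= x -> mem (F y) s) -> mem x s.
have dX : dfn (fun e => X (e 0)) by rewrite /X; pa_dfn.
have X0 : X z0 by [].
have XF x : X x -> X (F x).
  move=> Xx s s0 cl; apply: (cl x _ (lexx _)); apply: Xx => // y ys hy; apply: cl => //.
  by apply: le_trans hy (le_trans (le_addr _ _) (Fgt x)).
exists X; split=> //.
suff H : forall x, forall x', x' <= x -> X x' -> forall y, X y -> x' + z1 <= y -> F x' <= y.
  by move=> x y Xx; apply: (H x x (lexx _)).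
have base : forall x, (forall x', x' + z1 <= x -> X x' -> forall y, X y -> x' + z1 <= y -> F x' <= y) ->
    X x -> forall y, X y -> x + z1 <= y -> F x <= y.
  move=> x IH Xx w Xw hxw; apply: NNPP => nF.
  (* The elements of [X] up to [x] form a set closed under [F] up to [w], so [w] would belong to it
     although [x] is smaller than [w]. *)
  have [s hs] := @comprehension (fun y c => y <= c 0 /\ X y) (fun _ => x) w ltac:(pa_dfn).
  have : mem w s.
    apply: Xw; first by apply/hs; [exact: le0x|split=> //; exact: le0x].
    move=> y ys hFy.
    have hy : y <= w by apply: le_trans hFy; apply: le_trans (Fgt y); exact: le_addr.
    have [hyx Xy] := proj1 (hs y hy) ys.
    apply/hs => //; split; last exact: XF.
    case: (classic (y = x)) => [Eyx|nyx]; first by case: nF; rewrite -Eyx.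
    have hlt : y + z1 <= x by rewrite -ltE; split.
    exact: (IH y hlt Xy x Xx hlt).
  move/hs => /(_ (lexx _)) [hwx _].
  exact: (@succ_le_irr x (le_trans hxw hwx)).
apply: PA_ind; first by pa_dfn.
- move=> x' h; have -> := le_anti h (le0x _); apply: base => x'' h'.
  by have := le_anti h' (le0x _) => /addS_neq0.
- move=> x IH x'; rewrite le_succ => -[/IH //|-> ]; apply: base => x'' h'.
  apply: IH; case: (le_lt_total x'' x) => // h.
  by have := le_trans (le_add h (lexx z1)) h' => /succ_le_irr.
Qed.

Lemma iterate_below (X : N -> Prop) F y : growing F -> dfn (fun e => X (e 0)) -> X z0 ->
  (forall x, X x -> X (F x)) -> exists g, [/\ X g, g <= y, y + z1 <= F g &
    forall w, X w -> w <= y -> w <= g].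
Proof.
move=> [dF Fgt Fmono] dX X0 XF.
have [||g [[Xg hg] gmax]] := @greatest_env (fun g c => X g /\ g <= c 0) (fun _ => y) y ltac:(pa_dfn).
- by exists z0; split=> //; exact: le0x.
- by move=> x [].
exists g; split=> //; last by move=> w Xw hw; apply: gmax.
rewrite -not_le => hF; have := gmax (F g) (conj (XF _ Xg) hF).
by move/(le_trans (Fgt g)) => /succ_le_irr.
Qed.

(** * The case where [down M] is the point a, with [B] and [C] the points b and c *)

Section CofinalThenEnd.
Variables M B C : N -> Prop.
Hypotheses (eM : elem M) (eB : elem B) (eC : elem C).
Hypotheses (AB : forall x, down M x -> B x) (MC : forall x, M x -> C x).
Hypotheses (BC : forall x, B x -> C x -> M x).
Hypothesis hj : forall x, join (down M) C x.
Variables (c0 zB : N).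
Hypotheses (Cc0 : C c0) (Mc0 : ~ M c0) (BzB : B zB) (AzB : ~ down M zB).
Hypothesis minC : forall S, elem S -> (forall x, M x -> S x) -> (forall x, S x -> C x) ->
  (forall x, S x -> M x) \/ (forall x, C x -> S x).
Hypothesis minB : forall S, elem S -> (forall x, M x -> S x) -> (forall x, S x -> B x) ->
  (forall x, S x -> down M x) \/ (forall x, B x -> S x).
Hypothesis aboveA : forall S, elem S -> (forall x, down M x -> S x) ->
  (forall x, S x -> B x) \/ (forall x, S x).

Let MB x : M x -> B x. Proof. by move/sub_down/AB. Qed.

(** An element of [C] below one of [M] lies in [down M], hence in [B], and so in [M]. *)
Let M_below_C m c : M m -> C c -> ~ M c -> m + z1 <= c.
Proof.
move=> Mm Cc nMc; rewrite -not_le => h; apply: nMc; apply: BC => //.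
by apply: AB; exists m.
Qed.

Let A_below a b : down M a -> ~ down M b -> a <= b.
Proof.
by move=> Aa nAb; case: (le_total a b) => // h; case: nAb; apply: down_le h Aa.
Qed.

(* If [c <= z], then [z] lies below [F c] for a growing [F], so that among the
   iterates of [F] the last one below [z] is at most two steps after the last
   one below [c]; it thus belongs to both [B] and [C], hence to [M]. *)
Lemma gap_below z c : B z -> ~ down M z -> C c -> ~ M c -> z + z1 <= c.
Proof.
move=> Bz nAz Cc nMc; rewrite -not_le => hcz.
have [a [k [[m [Mm ham]] Ck [P [dP Pz Pu]]]]] := hj z.
have [G [[dG Ggt Gmono] Gdom]] := dominating dP.
(* An element of [C] above [z], since both arguments used to define [z] are at most [m + k]. *)
pose c' := G (m + k).
have Cc' : C c' by apply: (elem_fun1 eC) => //; apply: (elem_add eC) => //; exact: MC.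
have hzc' : z <= c'.
  apply: Gdom Pz Pu; last exact: le_addl.
  by apply: le_trans ham (le_addr _ _).
(* By minimality of [C] over [M], the element [c] generates [C] over [M]. *)
have [e [Me [Q [dQ Qc' Qu]]]] : exists e, M e /\ dcl (pair e c) c'.
  apply: join_dcl => //; case: (minC (S := join M (dcl c))) => //.
  - by apply: elem_join => //; exact: elem_dcl.
  - by move=> x; apply: joinl; exact: elem_dcl.
  - by apply: join_sub => // x; apply: dcl_sub.
  - by move=> h; case: nMc; apply: h; apply: joinr => //; exact: dcl_refl.
  - by apply.
have [F [gF Fdom]] := dominating dQ; have [dF Fgt Fmono] := gF.
have hzF : z <= F c.
  apply: le_trans hzc' _; apply: Fdom Qc' Qu; last exact: lexx.
  by apply: le_trans (M_below_C Me Cc nMc); exact: le_addr.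
have [X [dX X0 XF Xgap]] := iterates gF.
have [x [Xx hxc hcF xmax]] := iterate_below c gF dX X0 XF.
have [w [Xw hwz hzFw wmax]] := iterate_below z gF dX X0 XF.
have Cx : C x.
  apply: (@elem_uniq C (fun x c => (X x /\ x <= c 0) /\ forall w, X w -> w <= c 0 -> w <= x)
    (fun _ => c)) => //; first by pa_dfn.
  by move=> y [[Xy hy] ymax]; apply: le_anti; auto.
have Bw : B w.
  apply: (@elem_uniq B (fun x c => (X x /\ x <= c 0) /\ forall w, X w -> w <= c 0 -> w <= x)
    (fun _ => z)) => //; first by pa_dfn.
  by move=> y [[Xy hy] ymax]; apply: le_anti; auto.
have hxw : x <= w by apply: wmax => //; apply: le_trans hxc hcz.
have CF y : C y -> C (F y) by apply: (elem_fun1 eC).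
have Cw : C w.
  case: (classic (x = w)) => [<- //|nxw].
  have h1 : F x <= w by apply: Xgap => //; rewrite -ltE.
  case: (classic (F x = w)) => [<-|nFw]; first exact: CF.
  have h2 : F (F x) <= w by apply: Xgap => //; [exact: XF|rewrite -ltE].
  (* As [c] is below [F x], the bound [z <= F c] gives [w <= F (F x)]. *)
  have -> : w = F (F x); last exact: (CF _ (CF _ Cx)).
  apply: le_anti => //; apply: le_trans hwz _; apply: le_trans hzF _.
  by apply: Fmono; apply: le_trans hcF; exact: le_addr.
have Mw : M w by apply: BC.
apply: nAz; exists (F w); split; first exact: (elem_fun1 eM).
by apply: le_trans hzFw; exact: le_addr.
Qed.

Lemma B_below_C b c : B b -> C c -> ~ M c -> b + z1 <= c.
Proof.
move=> Bb Cc nMc; case: (classic (down M b)) => [[m [Mm hbm]]|nAb]; last exact: gap_below.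
apply: le_trans (M_below_C Mm Cc nMc); apply: le_add => //; exact: lexx.
Qed.

(** Otherwise [y] generates everything over [down M]. Then [c0] is defined from [y] and some
    [a <= y], so a growing [F] gives [c0 <= F y <= F b], while [F b] is in [B] and hence below
    [c0]. *)
Lemma B_initial b y : B b -> y <= b -> B y.
Proof.
move=> Bb hyb; case: (classic (down M y)) => [/AB //|nAy].
have eA := elem_down eM.
have [||h|h] := aboveA (S := join (down M) (dcl y)).
- by apply: elem_join => //; exact: elem_dcl.
- by move=> x; apply: joinl; exact: elem_dcl.
- by apply: h; apply: joinr => //; exact: dcl_refl.
have [a [Aa [Q [dQ Qc Qu]]]] := join_dcl eA (h c0).
have [F [[dF Fgt Fmono] Fdom]] := dominating dQ.
have hc : c0 <= F b.
  apply: le_trans (Fmono _ _ hyb); apply: Fdom Qc Qu; last exact: lexx.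
  exact: A_below.
have BFb : B (F b) by apply: (elem_fun1 eB).
by have := le_trans (B_below_C BFb Cc0 Mc0) hc => /succ_le_irr.
Qed.
Lemma M_eq_BC x : C x -> down M x -> M x.
Proof. by move=> Cx Ax; apply: BC => //; apply: AB. Qed.

(** * Truth in [B] computed by the coded family *)

Section Truth.
Variables (P : N -> Prop) (c m z : N).
Hypotheses (dP : dfn (fun e => P (e 0))) (Cc : C c) (Mm : M m).
Hypotheses (Bz : B z) (Az : ~ down M z).
(** The value [s] at [v] of the partial function that [P] defines from [c]; [z] is one of these
    values. *)
Definition bound v s c := P (pair s (pair v c)) /\ forall s', P (pair s' (pair v c)) -> s' = s.
Hypothesis zbound : exists j, j <= m /\ bound j z c.

Let dbound : dfn (fun e => bound (e 0) (e 1) (e 2)).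
Proof. by rewrite /bound; pa_dfn. Qed.

Lemma bound_uniq v s s' : bound v s c -> bound v s' c -> s' = s.
Proof. by move=> [_ h] [h' _]; apply: h. Qed.

(* The bounds with index in [M] are coinitial in [C] minus [M]: take the largest
   bound below [x], which is at least [z]. *)
Lemma bound_coinitial x : C x -> ~ M x ->
  exists v s, [/\ M v, C s, ~ M s, bound v s c & s <= x].
Proof.
move=> Cx nMx; have [j [hj' bz]] := zbound.
pose G s e := s <= e 0 /\ exists v, v <= e 1 /\ bound v s (e 2).
pose e0 := nth z0 [:: x; m; c].
have [|||s [[hsx [v [hv bv]]] smax]] := @greatest_env G e0 x.
- by rewrite /G; pa_dfn; apply: (dfn_app3 dbound); dfn.
- exists z; split; last by exists j.
  by apply: le_trans (B_below_C Bz Cx nMx); exact: le_addr.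
- by move=> s [].
have hzs : z <= s.
  apply: smax; split; last by exists j.
  by apply: le_trans (B_below_C Bz Cx nMx); exact: le_addr.
have Ce i : C (e0 i) by apply: all_nth; [exact: elem0|move=> /=; auto].
have Cs : C s.
  apply: (@elem_uniq C (fun s e => G s e /\ forall y, G y e -> y <= s) e0) => //.
  + by rewrite /G; pa_dfn; apply: (dfn_app3 dbound); dfn.
  + by split=> //; split=> //; exists v.
  + move=> y [Gy ymax]; apply: le_anti; first exact: smax.
    by apply: ymax; split=> //; exists v.
have nMs : ~ M s by move=> Ms; apply: Az; exists s.
(* An index for [s] up to [m] is found again in [C], and therefore lies in [M]. *)
have [|||v' [Cv' [hv' bv']]] := elem_env eC (R := fun v e => v <= e 0 /\ bound v (e 1) (e 2))
  (c := nth z0 [:: m; s; c]).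
- by pa_dfn; apply: (dfn_app3 dbound); dfn.
- by apply: all_nth; [exact: elem0|move=> /=; auto].
- by exists v.
by exists v', s; split=> //; apply: M_eq_BC => //; exists m.
Qed.

Variables d p : N.
Hypotheses (Cd : C d) (Md : ~ M d) (Cp : C p).
Hypothesis fam : forall i a, i <= d -> a <= d -> (mem (pair i a) p <-> step bound c d p i a).

Let M_le_d x : M x -> x <= d.
Proof. by move=> Mx; apply: le_trans (M_below_C Mx Cd Md); exact: le_addr. Qed.

Lemma M_idx k l r v : M l -> M r -> M v -> M (idx k l r v).
Proof.
move=> Ml Mr Mv; apply: (elem_add eM); last exact: elem1.
exact: (elem_pair eM (elem_num _ eM) (elem_pair eM Ml (elem_pair eM Mr Mv))).
Qed.

Definition represented (Q : N -> Prop) := dfn (fun e => Q (e 0)) /\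
  exists i, M i /\ forall a, M a -> (mem (pair i a) p <-> Q a).

Definition represents i (Q : N -> Prop) :=
  M i /\ forall a, M a -> (mem (pair i a) p <-> Q a).

(** The greatest [y] up to [x] below which row [i] agrees with [Q] is definable in [C]. It is not in
    [M], because every element of [M] has this property and [M] is closed under successor. *)
Lemma overspill (Q : N -> Prop) i x : dfn (fun e => Q (e 0)) -> represents i Q ->
  C x -> ~ M x -> exists y, [/\ C y, ~ M y, y <= x &
    forall a, a <= y -> (mem (pair i a) p <-> Q a)].
Proof.
move=> dQ [Mi hi] Cx nMx.
pose G y e := y <= e 0 /\ forall a, a <= y -> (mem (pair (e 1) a) (e 2) <-> Q a).
pose e0 := nth z0 [:: x; i; p].
have dG : dfn (fun e => G (e 0) (fun i => e i.+1)) by rewrite /G; pa_dfn.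
have Ce k : C (e0 k) by apply: all_nth; [exact: elem0|move=> /=; auto].
have GM y : M y -> G y e0.
  move=> My; split=> [|a ha]; first by apply: le_trans (M_below_C My Cx nMx); exact: le_addr.
  (* A disagreement at any [a <= y] yields one in [C] below [y], which is then in [M]. *)
  apply: NNPP => ne.
  have [||b [Cb [hb []]]] := elem_env eC (R := fun a e => a <= e 0 /\
    ~ (mem (pair (e 1) a) (e 2) <-> Q a)) (c := nth z0 [:: y; i; p]) ltac:(pa_dfn).
  - by apply: all_nth; [exact: elem0|move=> /=; auto].
  - by exists a.
  by apply: hi; apply: M_eq_BC => //; exists y.
have [||y [Gy ymax]] := greatest_env (R := G) (c := e0) (b := x) dG.
- by exists z0; apply: GM; exact: elem0.
- by move=> y [].
exists y; case: (Gy) => hyx hy; split=> //.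
  apply: (@elem_uniq C (fun y e => G y e /\ forall w, G w e -> w <= y) e0) => //.
    by rewrite /G; pa_dfn.
  by move=> w [Gw wmax]; apply: le_anti; auto.
move=> My; apply: (@succ_le_irr y); apply: ymax; apply: GM.
by apply: (elem_add eM) => //; exact: elem1.
Qed.

(** Overspill carries both agreements up to some element of [C] outside [M]. A bound below that
    element, with index in [M], still lies above all of [B]. *)
Lemma window (Q Q' : N -> Prop) i i' : dfn (fun e => Q (e 0)) -> dfn (fun e => Q' (e 0)) ->
  represents i Q -> represents i' Q' -> exists v, [/\ M v,
    forall b, B b -> small bound c d v b &
    forall b, small bound c d v b ->
      (below d p i b <-> Q b) /\ (below d p i' b <-> Q' b)].
Proof.
move=> dQ dQ' ri ri'.
have [x [Cx nMx hxd hx]] := overspill dQ ri Cd Md.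
have [x' [Cx' nMx' hx'x hx']] := overspill dQ' ri' Cx nMx.
have [v [s [Mv Cs nMs bv hs]]] := bound_coinitial Cx' nMx'.
exists v; split=> // b.
  move=> Bb; split; first by apply: le_trans (B_below_C Bb Cd Md); exact: le_addr.
  by exists s; split=> //; apply: le_trans (B_below_C Bb Cs nMs); exact: le_addr.
move=> [hbd [s' [bs' hbs']]]; rewrite (bound_uniq bv bs') in hbs'.
have hb' := le_trans hbs' hs; have hb := le_trans hb' hx'x.
by rewrite /below -(hx b hb) -(hx' b hb'); tauto.
Qed.

Definition expressible (Q : N -> Prop) :=
  dfn (fun e => Q (e 0)) /\ exists i, represents i Q.

Lemma represents_idx k l r v (Q : N -> Prop) : (k < 11)%N -> M l -> M r -> M v ->
  (forall a, M a -> (clause k (below d p l) (below d p r) (small bound c d v) a <-> Q a)) ->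
  exists i, represents i Q.
Proof.
move=> hk Ml Mr Mv H; exists (idx k l r v); split; first exact: M_idx.
move=> a Ma; rewrite -H // fam ?stepE //; apply: M_le_d => //; exact: M_idx.
Qed.

Lemma expressible_imp Q Q' : expressible Q -> expressible Q' ->
  expressible (fun a => Q a -> Q' a).
Proof.
move=> [dQ [i [Mi hi]]] [dQ' [i' [Mi' hi']]]; split; first by pa_dfn.
apply: (@represents_idx 8 i i' z0) => //; first exact: elem0.
move=> a Ma /=; rewrite /below -hi // -hi' //.
by have := M_le_d Ma; tauto.
Qed.

(** For [a] in [M] a counterexample can be taken in [M], so that it falls inside the window used as
    range of the quantifier. *)
Lemma expressible_all Q : expressible Q -> expressible (fun a => forall u, Q (pair u a)).
Proof.
move=> [dQ [i ri]]; split; first by pa_dfn.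
have [v [Mv MS SQ]] := window dQ dQ ri ri; case: (ri) => Mi _.
apply: (@represents_idx 9 i i v) => // a Ma /=; split=> [H u|H u hu]; last first.
  by case: (SQ _ hu) => -> _.
apply: NNPP => nQ.
have [|u' [Mu' nQ']] := elem_env eM (R := fun u e => ~ Q (pair u (e 0)))
  (c := fun _ => a) ltac:(pa_dfn) (fun _ => Ma); first by exists u.
apply: nQ'; have S' : small bound c d v (pair u' a) by apply/MS/MB/(elem_pair eM).
by case: (SQ _ S') => <- _; apply: H.
Qed.

(** The common form of the clauses for sums, products, equality and order; [f] extracts the
    environment. Elementarity of [M] places the two values inside the window. *)
Lemma expressible_op k (Q Q' : N -> Prop) (f : N -> N) (R : N -> N -> N -> Prop) :
  (k < 11)%N -> (forall I J S a, clause k I J S a <->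
    exists u v, (S (pair u (f a)) /\ S (pair v (f a))) /\
      (I (pair u (f a)) /\ J (pair v (f a))) /\ R u v a) ->
  dfn (fun e => e 0 = f (e 1)) -> dfn (fun e => R (e 0) (e 1) (e 2)) ->
  expressible Q -> expressible Q' ->
  expressible (fun a => exists u v, (Q (pair u (f a)) /\ Q' (pair v (f a))) /\ R u v a).
Proof.
move=> hk hc df dR [dQ [i ri]] [dQ' [i' ri']].
split; first by pa_dfn; apply: (dfn_app3 dR); dfn.
have [w [Mw MS SQ]] := window dQ dQ' ri ri'; case: (ri) (ri') => Mi _ [Mi' _].
apply: (@represents_idx k i i' w) => // a Ma; rewrite hc; split.
  move=> [u [v [[hu hv] [[Iu Jv] Ruv]]]]; exists u, v; split=> //.
  by case: (SQ _ hu) => <- _; case: (SQ _ hv) => _ <-.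
move=> [u [v [[Qu Qv] Ruv]]].
have Mfa : M (f a) by apply: (elem_fun1 eM).
have [|b [Mb Hb]] := elem_env eM (R := fun b e =>
    (Q (pair (pi1 b) (f (e 0))) /\ Q' (pair (pi2 b) (f (e 0)))) /\ R (pi1 b) (pi2 b) (e 0))
  (c := fun _ => a) ltac:(pa_dfn; apply: (dfn_app3 dR); pa_dfn) (fun _ => Ma).
- by exists (pair u v); rewrite pi1_pair pi2_pair.
case: Hb => -[Qb Qb'] Rb; exists (pi1 b), (pi2 b).
have S1 : small bound c d w (pair (pi1 b) (f a)).
  by apply/MS/MB/(elem_pair eM) => //; exact: elem_pi1.
have S2 : small bound c d w (pair (pi2 b) (f a)).
  by apply/MS/MB/(elem_pair eM) => //; exact: elem_pi2.
by case: (SQ _ S1) => -> _; case: (SQ _ S2) => _ ->.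
Qed.

Lemma expressible_iff (Q Q' : N -> Prop) : (forall a, Q a <-> Q' a) ->
  expressible Q -> expressible Q'.
Proof.
move=> QQ' [dQ [i [Mi hi]]]; split; first exact: dfn_iff dQ.
by exists i; split=> // a Ma; rewrite hi.
Qed.

Lemma expressible_term t : expressible (fun a => pi1 a = eval (dec (pi2 a)) t).
Proof.
have M0 := elem0 eM.
have dE s : dfn (fun e => pi1 (e 0) = eval (dec (pi2 (e 0))) s).
  by pa_dfn; apply: dff_eval_dec; pa_dfn.
elim: t => [n|||t IHt s IHs|t IHt s IHs] /=.
- elim: n => [|n [_ [i [Mi hi]]]].
    split; first exact: (dE (tVar 0)).
    by apply: (@represents_idx 0 z0 z0 z0).
  split; first exact: (dE (tVar n.+1)).
  (* Variable [n.+1] is variable [n] evaluated in the tail of the environment. *)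
  apply: (@represents_idx 1 i z0 z0) => // a Ma /=.
  have Mb : M (pair (pi1 a) (pi2 (pi2 a))).
    by apply: elem_pair => //; [|apply: elem_pi2 => //]; [apply: elem_pi1|apply: elem_pi2].
  rewrite /below hi // pi1_pair pi2_pair.
  by split=> [[]//|]; split=> //; exact: M_le_d.
- by split; [exact: (dE tZero)|apply: (@represents_idx 2 z0 z0 z0)].
- by split; [exact: (dE tOne)|apply: (@represents_idx 3 z0 z0 z0)].
- apply: expressible_iff (@expressible_op 4 _ _ pi2 (fun u v a => pi1 a = u + v) _ _ _ _ IHt IHs) => //; try by pa_dfn.
  move=> a; split=> [[u [v]]|->]; rewrite ?pi1_pair ?pi2_pair; first by case=> -[-> ->].
  by exists (eval (dec (pi2 a)) t), (eval (dec (pi2 a)) s); rewrite !pi1_pair !pi2_pair.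
- apply: expressible_iff (@expressible_op 5 _ _ pi2 (fun u v a => pi1 a = u * v) _ _ _ _ IHt IHs) => //; try by pa_dfn.
  move=> a; split=> [[u [v]]|->]; rewrite ?pi1_pair ?pi2_pair; first by case=> -[-> ->].
  by exists (eval (dec (pi2 a)) t), (eval (dec (pi2 a)) s); rewrite !pi1_pair !pi2_pair.
Qed.

Lemma expressible_sat q : expressible (fun a => sat (dec a) q).
Proof.
have M0 := elem0 eM.
elim: q => [t s|t s||q IHq r IHr|q IHq] /=.
- apply: expressible_iff (@expressible_op 6 _ _ id (fun u v a => u = v) _ _ _ _
    (expressible_term t) (expressible_term s)) => //; try by pa_dfn.
  move=> a; split=> [[u [v]]|E]; rewrite ?pi1_pair ?pi2_pair; first by case=> -[-> ->].
  by exists (eval (dec a) t), (eval (dec a) s); rewrite !pi1_pair !pi2_pair.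
- apply: expressible_iff (@expressible_op 7 _ _ id (fun u v a => u <= v) _ _ _ _
    (expressible_term t) (expressible_term s)) => //; try by pa_dfn.
  move=> a; split=> [[u [v]]|E]; rewrite ?pi1_pair ?pi2_pair; first by case=> -[-> ->].
  by exists (eval (dec a) t), (eval (dec a) s); rewrite !pi1_pair !pi2_pair.
- by split; [dfn|apply: (@represents_idx 10 z0 z0 z0)].
- exact: expressible_imp.
- apply: expressible_iff (expressible_all IHq) => a.
  by split=> H u; have := H u; rewrite dec_pair.
Qed.

(** Representation is checked on [M] only; a window around [B] extends it to [B]. *)
Lemma represented_on_B (Q : N -> Prop) : dfn (fun e => Q (e 0)) ->
  exists i, M i /\ forall a, B a -> (mem (pair i (pair a z0)) p <-> Q a).
Proof.
move=> [q Hq]; have [dS [i ri]] := expressible_sat q.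
have [v [Mv BS SQ]] := window dS dS ri ri; case: (ri) => Mi _.
exists i; split=> // a Ba.
have Bb : B (pair a z0) by apply: elem_pair => //; exact: elem0.
have [h _] := SQ _ (BS _ Bb); move: h; rewrite /below Hq /= pi1_pair => <-.
by split=> [|[]//]; split=> //; case: (BS _ Bb).
Qed.
End Truth.

(* Some [y] in [B] diagonalizes against all sets definable from [zB] and one
   parameter [e] in [M], although every element of [B] is so definable. *)
Lemma cofinal_then_end_false : False.
Proof.
have [j [c [[m [Mm hjm]] Cc [P [dP Pz Pu]]]]] := hj zB.
have dT : dfn (fun e => bound P (e 0) (e 1) (e 2)) by rewrite /bound; pa_dfn.
(* The element [c0] of [C] exceeds all of [M], so it bounds the indices and arguments needed; a code
   of the family can be chosen in [C]. *)
have [|||p [Cp fam]] := elem_env eC (R := fun p e => forall i a, i <= e 0 -> a <= e 0 ->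
   (mem (pair i a) p <-> step (bound P) (e 1) (e 0) p i a)) (c := nth z0 [:: c0; c]).
- by pa_dfn; apply: dfn_step; pa_dfn.
- by apply: all_nth; [exact: elem0|move=> /=; auto].
- exact: family.
move: fam => /= fam.
pose w := pair zB zB; have Bw : B w by apply: elem_pair.
(* The diagonal set: [k], read as a row and a parameter, is a member when that row rejects [k]
   together with the parameter and [zB]. *)
have [y0 hy0] := @comprehension (fun k e =>
  ~ mem (pair (pi1 k) (pair (pair k (pair (pi2 k) (e 0))) z0)) (e 1))
  (nth z0 [:: zB; p]) w ltac:(pa_dfn).
(* The part of [y0] up to [w] is recoded below some [W] in [B], hence inside the initial segment
   [B]. *)
have [W [BW hW]] := elem_env eB (R := fun W c => forall s, exists s', s' <= W /\
    forall k, k <= c 0 -> (mem k s' <-> mem k s))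
  (c := fun _ => w) ltac:(pa_dfn) (fun _ => Bw) (bounded_codes w).
have [y [hyW hy]] := hW y0; have By := B_initial BW hyW.
have [e [Me [R [dR Ry Ru]]]] : exists e, M e /\ dcl (pair e zB) y.
  apply: join_dcl => //; case: (minB (S := join M (dcl zB))) => //.
  - by apply: elem_join => //; exact: elem_dcl.
  - by move=> x; apply: joinl; exact: elem_dcl.
  - by apply: join_sub => // x; apply: dcl_sub.
  - by move=> h; case: AzB; apply: h; apply: joinr => //; exact: dcl_refl.
  - by apply.
have zb : exists j, j <= m /\ bound P j zB c by exists j.
have [i [Mi hi]] := represented_on_B dP Cc Mm BzB AzB zb Cc0 Mc0 Cp fam
  (Q := fun a => exists y, (R (pair y (pi2 a)) /\ forall y', R (pair y' (pi2 a)) -> y' = y) /\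
     mem (pi1 a) y) ltac:(pa_dfn).
(* At this index the diagonal set meets its own definition; [k] is below [w] because [M] lies below
   [zB]. *)
pose k := pair i e; have Mk : M k by apply: elem_pair.
have hkw : k <= w.
  by apply: le_pair; apply: A_below => //; apply: sub_down.
have Ba : B (pair k (pair e zB)) by apply: (elem_pair eB); [exact: MB|apply: (elem_pair eB) => //; exact: MB].
have := hi _ Ba; rewrite pi1_pair pi2_pair => E.
have E1 : mem k y <-> ~ mem (pair i (pair (pair k (pair e zB)) z0)) p.
  by rewrite hy // hy0 //= /k pi1_pair pi2_pair.
have E2 : mem k y <-> mem (pair i (pair (pair k (pair e zB)) z0)) p.
  rewrite E; split=> [h|[y' [[Ry' _] h]]]; first by exists y.
  by rewrite -(Ru _ Ry').
tauto.
Qed.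
End CofinalThenEnd.
(** * The pentagon *)

Section Lattice.
Variable M : substructure N.
Hypothesis sM : elem_sub M.

Lemma elem_of_sub (K : substructure N) : elem_sub K -> elem K.
Proof.
move=> sK; split; first exact: univ_zero.
- by move=> x y Kx Ky; rewrite /pair; do ?[apply: univ_add|apply: univ_mul].
- move=> P dP a Ka [x Px].
  have [p Hp] : dfn (fun e => P (pair (e 0) (e 1))) by pa_dfn.
  pose e (_ : nat) : induced K := exist _ a Ka.
  have /(sK (fEx p) e)/sat_ex [[x' Kx'] Hx'] : sat (fun i => proj1_sig (e i)) (fEx p).
    by rewrite sat_ex; exists x; rewrite Hp.
  exists x'; split=> //; apply/(Hp (scons x' (fun _ => a))).
  have := proj1 (sK _ _) Hx'; congr (sat _ p).
  by apply: functional_extensionality; case.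
Qed.

Definition sub_of_elem S (eS : elem S) : substructure N :=
  Substructure (elem0 eS) (elem1 eS) (elem_add eS) (elem_mul eS).

(** The Tarski-Vaught test: at a quantifier, a counterexample is moved into [S] by [elem_env]. *)
Lemma elem_sub_of_elem S (eS : elem S) : elem_sub (sub_of_elem eS).
Proof.
have evalE t (e : nat -> induced (sub_of_elem eS)) :
    proj1_sig (eval e t) = eval (fun i => proj1_sig (e i)) t.
  by elim: t => //= t1 <- t2 <-.
elim=> [t1 t2|t1 t2||p IHp q IHq|p IHp] e /=.
- rewrite -!evalE; split=> [-> //|]; case: (eval e t1) (eval e t2) => [x Sx] [y Sy] /= E.
  by subst y; congr exist; apply: proof_irrelevance.
- by rewrite -!evalE.
- by [].
- by rewrite IHp IHq.
- have E a : sat (scons a e) p <-> sat (scons (proj1_sig a) (fun i => proj1_sig (e i))) p.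
    rewrite IHp; suff -> : (fun i => proj1_sig (scons a e i)) =
      scons (proj1_sig a) (fun i => proj1_sig (e i)) by [].
    by apply: functional_extensionality; case.
  split=> H; last by move=> a; rewrite E.
  apply: NNPP => nH; have [|||x [Sx Hx]] := elem_env eS (R := fun x e => ~ sat (scons x e) p)
    (c := fun i => proj1_sig (e i)).
  + by exists (fNot p) => e' /=; rewrite scons_eta.
  + by move=> i; exact: proj2_sig (e i).
  + apply: NNPP => h; apply: nH => x; apply: NNPP => hx; apply: h.
    by exists x.
  by apply: Hx; exact: (proj1 (E (exist _ x Sx)) (H _)).
Qed.

Lemma prec_of_subset (K K' : substructure N) : elem_sub K -> elem_sub K' ->
  (forall x, K x -> K' x) -> prec K K'.
Proof. by move=> sK sK' s; exists s => p e; rewrite (sK p e) (sK' p _). Qed.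

Lemma subset_of_prec (K K' : substructure N) : prec K K' -> forall x, K x -> K' x.
Proof. by case. Qed.

Lemma Lt_leE (K K' : Lt M) :
  Lt_le K K' <-> forall x, proj1_sig K x -> proj1_sig K' x.
Proof.
case: K K' => [K [h sK]] [K' [h' sK']] /=; split; first exact: subset_of_prec.
exact: prec_of_subset.
Qed.

(** Every elementary substructure containing [M] is a point of the pentagon, so intersections, joins
    and [down M] can be located in it. *)
Lemma not_pentagon : ~ end_ext M -> ~ cofinal_ext M ->
  ~ order_isomorphic (@Lt_le N M) N5_le.
Proof.
move=> nend ncof [f [[g fK gK] fle]].
pose K (q : pentagon) : N -> Prop := proj1_sig (g q).
have eM := elem_of_sub sM.
have eK q : elem (K q) by apply: elem_of_sub; case: (proj2_sig (g q)).
have MK q x : M x -> K q x by apply: subset_of_prec; case: (proj2_sig (g q)).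
have Kle q r : (forall x, K q x -> K r x) <-> N5_le q r.
  by rewrite -Lt_leE fle !gK.
have Kall S : elem S -> (forall x, M x -> S x) -> exists q, S = K q.
  move=> eS MS; have sS := @elem_sub_of_elem S eS.
  pose L : Lt M := exist _ (sub_of_elem eS) (conj (prec_of_subset sM sS MS) sS).
  by exists (f L); rewrite /K fK.
have [m Em] := Kall _ eM (fun x => id).
have K0 : forall x, K N5_0 x -> M x by rewrite Em; apply/Kle.
have [t Et] := Kall _ elem_all (fun x _ => I).
have K1 x : K N5_1 x.
  suff H : forall y, K t y -> K N5_1 y by apply: H; rewrite -Et.
  by apply/Kle; case: (t).
(* The point [d] of [down M] is not the bottom, as the extension would be end, nor the top, as it
   would be cofinal. *)
have [d Ed] := Kall _ (elem_down eM) (fun x => @sub_down M x).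
have d0 : d <> N5_0.
  move=> E; apply: nend; split=> // a b Ma nMb; rewrite ltE -not_le => hba.
  by apply/nMb/K0; rewrite -E -Ed; exists a.
have d1 : d <> N5_1.
  move=> E; apply: ncof; split=> // b.
  have [a [Ma hba]] : down M (b + z1) by rewrite Ed E.
  by exists a; rewrite ltE.
have interval S q : elem S -> (forall y, M y -> S y) -> (forall y, S y -> K q y) ->
    exists2 s, S = K s & N5_le s q.
  by move=> eS MS SK; have [s Es] := Kall S eS MS; exists s => //; apply/Kle; rewrite -Es.
have meet q r x : (forall s, N5_le s q -> N5_le s r -> s = N5_0) -> K q x -> K r x -> M x.
  move=> h Kqx Krx.
  have [s Es] : exists s, (fun y => K q y /\ K r y) = K s.
    apply: Kall; first exact: elem_inter.
    by move=> u Mu; split; exact: MK.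
  have Ks u : K s u <-> K q u /\ K r u by rewrite -Es.
  apply: K0; rewrite -(h s); try (by apply/Kle => u /Ks []).
  by rewrite Ks.
have join_all q r : (forall s, N5_le q s -> N5_le r s -> s = N5_1) ->
    forall x, join (K q) (K r) x.
  move=> h x.
  have [|s Es] := Kall (join (K q) (K r)) (elem_join (eK q) (eK r)).
    by move=> u Mu; apply: joinl => //; exact: MK.
  rewrite Es (h s) //; apply/Kle => u Ku; rewrite -Es.
    exact: joinl.
  exact: joinr.
have strict q r : ~ N5_le q r -> exists z, K q z /\ ~ K r z.
  move=> h; apply: NNPP => nz; apply: h; apply/Kle => z Kz.
  by apply: NNPP => nKz; apply: nz; exists z.
have ab : forall z, K N5_a z -> K N5_b z by apply/Kle.
have Kd x : down M x <-> K d x by rewrite Ed.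
case: d Ed d0 d1 Kd => // Ed _ _ Kd.
(* The case where [down M] is the point a. *)
- have [zB [BzB AzB]] := @strict N5_b N5_a id.
  have [c0 [Cc0 nKc0]] := @strict N5_c N5_0 id.
  apply: (@cofinal_then_end_false M (K N5_b) (K N5_c) eM (eK _) (eK _) _ (MK _) _ _ c0 zB) => //.
  + by move=> x /Kd /ab.
  + by move=> x; apply: meet; case.
  + by rewrite Ed; apply: join_all; case.
  + by move=> /(MK N5_0).
  + by rewrite Ed.
  + move=> S eS MS /(interval _ _ eS MS) [[] -> //= _]; [left=> x; exact: K0|by right].
  + move=> S eS MS /(interval _ _ eS MS) [[] -> //= _]; rewrite Ed.
    * by left=> x /K0 /(MK N5_a).
    * by left.
    * by right.
  + move=> S eS AS; have [|s Es] := Kall S eS; first by move=> x /sub_down /AS.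
    have : N5_le N5_a s by apply/Kle => x; rewrite -Kd -Es; exact: AS.
    rewrite Es; case: (s) => //= _.
    * by left.
    * by left.
    * by right.
(* The case where [down M] is the point b: a and c join to the top, while b and c meet in the
   bottom. *)
- have [z [Bz nAz]] := @strict N5_b N5_a id.
  apply: nAz; apply: (@join_within_down_trivial M (K N5_a) (K N5_c)) => //.
  + exact: MK.
  + exact: MK.
  + by move=> x /ab /Kd.
  + by move=> x /Kd; apply: meet; case.
  + by apply: join_all; case.
  + exact/Kd.
(* The case where [down M] is the point c, with the same join and meet. *)
- have [z [Bz nAz]] := @strict N5_b N5_a id.
  apply: nAz; apply: (@join_down_trivial M (K N5_a) (K N5_b)) => //.
  + exact: MK.
  + by move=> x /Kd Cx Bx; apply: (meet N5_c N5_b) Cx Bx; case.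
  + by rewrite Ed; apply: join_all; case.
Qed.
End Lattice.

End Model.

Theorem theorem3 (N : structure) (M : substructure N)
    (hM : models_PA (induced M)) (hN : models_PA N) (hmixed : mixed_ext M) :
  ~ order_isomorphic (@Lt_le N M) N5_le.
Proof. by case: hmixed => sM nend ncof; exact: not_pentagon. Qed.
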